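(* Let $V(u,x_1,x_2)$ be a smooth compactly supported potential on $\mathbb{R}\times\mathbb{R}^2$ which is radially symmetric, i.e. $V(u,x)$ depends only on $u$ and $r=|x|$. If $V$ does not vanish identically, then there exist radially symmetric solutions $u=u(r)$ of $$\Delta u = -V'_u(u,x_1,x_2)$$ (defined for $r>0$) which are not minimal for the functional $I(u)=\int \tfrac12(\nabla u)^2 - V(u,x_1,x_2)\,dx_1dx_2$.
   Context: A solution $u$ on a domain $D$ is minimal (a global minimiser) if for every bounded subdomain $\Omega\subset D$ with smooth boundary and every smooth $v$ on $\overline\Omega$ with $v=u$ on $\partial\Omega$, $\int_\Omega \tfrac12(\nabla u)^2 - V(u,x)\,dx \le \int_\Omega \tfrac12(\nabla v)^2 - V(v,x)\,dx$. *)

(* Defs.v *)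
From mathcomp Require Import all_boot all_order all_algebra.
From mathcomp Require Import all_classical all_reals all_analysis.
Import numFieldNormedType.Exports.
Import Order.TTheory GRing.Theory Num.Theory.
Set Implicit Arguments. Unset Strict Implicit. Unset Printing Implicit Defensive.
Local Open Scope ring_scope.
Local Open Scope classical_set_scope.

Fixpoint iderive (R : realType) (W : normedModType R) (vs : seq W)
    (f : W -> R) : W -> R :=
  match vs with
  | [::] => f
  | v :: vs' => 'D_v (iderive vs' f)
  end.

Definition smooth_on (R : realType) (W : normedModType R) (U : set W)
    (f : W -> R) : Prop :=
  forall (vs : seq W) (x : W), U x ->
    (forall v : W, derivable (iderive vs f) x v) /\
    {for x, continuous (iderive vs f)}.

Definition e1 (R : realType) : R * R := (1, 0).
Definition e2 (R : realType) : R * R := (0, 1).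
Definition eu (R : realType) : R * (R * R) := (1, (0, 0)).

Definition sqnorm2 (R : realType) (x : R * R) : R := x.1 ^+ 2 + x.2 ^+ 2.

Definition grad_sq (R : realType) (u : R * R -> R) (x : R * R) : R :=
  ('D_(e1 R) u x) ^+ 2 + ('D_(e2 R) u x) ^+ 2.

Definition laplacian (R : realType) (u : R * R -> R) (x : R * R) : R :=
  'D_(e1 R) ('D_(e1 R) u) x + 'D_(e2 R) ('D_(e2 R) u) x.

Definition leb2 (R : realType) := ((@lebesgue_measure R) \x (@lebesgue_measure R))%E.

Definition energy (R : realType) (V : R * (R * R) -> R) (Om : set (R * R))
    (u : R * R -> R) : \bar R :=
  (\int[@leb2 R]_(x in Om) ((2^-1 * grad_sq u x - V (u x, x))%:E))%E.

Definition smooth_bounded_domain (R : realType) (Om : set (R * R)) : Prop :=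
  open Om /\ connected Om /\ Om !=set0 /\ bounded_set Om /\
  forall p, (closure Om `\` Om) p ->
    exists r : R, 0 < r /\ exists phi : R * R -> R,
      smooth_on (ball p r) phi /\
      (forall x, ball p r x -> grad_sq phi x != 0) /\
      (forall x, ball p r x -> (Om x <-> phi x < 0)).

Definition minimal (R : realType) (V : R * (R * R) -> R) (D : set (R * R))
    (u : R * R -> R) : Prop :=
  forall Om : set (R * R), smooth_bounded_domain Om -> closure Om `<=` D ->
  forall (U : set (R * R)) (v : R * R -> R),
    open U -> closure Om `<=` U -> smooth_on U v ->
    (forall x, (closure Om `\` Om) x -> v x = u x) ->
    (energy V Om u <= energy V Om v)%E.

(* Main.v *)
Require Import Defs.
From mathcomp Require Import all_boot all_order all_algebra.
From mathcomp Require Import all_classical all_reals all_analysis.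
From mathcomp Require Import measurable_realfun.
From mathcomp Require Import ring lra.
Import numFieldNormedType.Exports.
Import Order.TTheory GRing.Theory Num.Theory.
Set Implicit Arguments. Unset Strict Implicit. Unset Printing Implicit Defensive.
Local Open Scope ring_scope.
Local Open Scope classical_set_scope.

(** In the variable [t = ln r] a radial function [u = y (ln r)] has energy
    proportional to the action [int y'^2 / 2 - w(y, t) dt] with
    [w(s, t) = e^(2 t) V(s, e^t)], and [u] solves the equation iff
    [y'' = - w_s(y, t)]. Suppose every such [u] is minimal.

    The constant [y = A], for [A] beyond the support of [V], is a solution of
    zero action. Comparing it on [[-L, L]] with
    [A + (c - A + d psi) (1 - t^2 / L^2)], whose kinetic energy is [O(d^2)] as
    [L -> oo], gives [int w(c + d psi, t) dt <= K d^2]. For [d = 0] this says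
    [int w(c, t) dt <= 0] for every [c].

    Conversely let [y] be a solution with [y(t0) = 0] and large speed
    [y'(t0) = p]. Adding its comparisons with [y + s phi] and [y - s phi] for a
    wide and high bump [s phi] cancels the terms linear in [s], while both
    shifted curves miss the support up to a negligible tail, so
    [int w(y, t) dt >= 0]. Letting [p -> oo] gives [int w(c, t0) dc >= 0] for
    every [t0].

    By Fubini the two families of integrals vanish, so with [psi = V_u(c, .)]
    the first comparison becomes [d int w_s(c, t) psi dt <= O(d^2)]; hence
    [V_u = 0] and [V = 0]. *)

(** * Calculus of antiderivatives *)

Section Calculus.
Variable R : realType.
Implicit Types (f g F G : R -> R) (a b c s t : R).

(** Two dimensions enter through the logarithm: in [t = ln r] the Dirichlet integral carries no
    weight, so over a window of length [2 L] a parabola of fixed height costs only [O(1/L)], and any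
    two constants are joined at a vanishing price. The windows leave every compact set, but the
    potential stays under control: it vanishes for large [t], and the weight [e^(2 t)] damps it as
    [t -> -oo]. Comparison with constants only bounds the means of [V] from one side. The opposite
    sign needs solutions whose action along the curve is localised: a fast one crosses the support
    in [u] within a time [O(1/p)], so it samples [V] at a single radius. Pushing it off the support
    changes the kinetic energy to first order in the shift, with unknown sign; this is why two
    opposite shifts are used together. Integrals over intervals are written as increments of an
    antiderivative, so that estimates reduce to comparing derivatives. Lebesgue integration remains
    only in the existence of antiderivatives and in the plane. *)

Definition has_deriv F f := forall t, is_derive t (1 : R) F (f t).

Lemma has_deriv_ext F f g : has_deriv F f -> f =1 g -> has_deriv F g.
Proof. by move=> Ff fg t; rewrite -fg. Qed.

Lemma has_deriv_cst c : has_deriv (fun=> c) (fun=> 0).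
Proof. by move=> t; exact: is_derive_cst. Qed.

Lemma has_deriv_id : has_deriv id (fun=> 1).
Proof. by move=> t; exact: is_derive_id. Qed.

Lemma has_derivD F G f g : has_deriv F f -> has_deriv G g ->
  has_deriv (fun t => F t + G t) (fun t => f t + g t).
Proof. by move=> Ff Gg t; apply: is_deriveD. Qed.

Lemma has_derivN F f : has_deriv F f -> has_deriv (fun t => - F t) (fun t => - f t).
Proof. by move=> Ff t; apply: is_deriveN. Qed.

Lemma has_derivB F G f g : has_deriv F f -> has_deriv G g ->
  has_deriv (fun t => F t - G t) (fun t => f t - g t).
Proof. by move=> Ff Gg t; apply: is_deriveB. Qed.

Lemma has_derivM F G f g : has_deriv F f -> has_deriv G g ->
  has_deriv (fun t => F t * G t) (fun t => f t * G t + F t * g t).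
Proof.
move=> Ff Gg t; have H := is_deriveM (Ff t) (Gg t).
by apply: (is_derive_eq H); rewrite /GRing.scale /= addrC mulrC.
Qed.

Lemma has_derivZ k F f : has_deriv F f ->
  has_deriv (fun t => k * F t) (fun t => k * f t).
Proof. by move=> Ff t; apply: (is_deriveZ k). Qed.

Lemma has_deriv_comp F G f g : has_deriv F f -> has_deriv G g ->
  has_deriv (fun t => F (G t)) (fun t => f (G t) * g t).
Proof. by move=> Ff Gg t; apply: (is_derive1_comp (Ff (G t)) (Gg t)). Qed.

Lemma has_deriv_expR : has_deriv (@expR R) (@expR R).
Proof. by move=> t; exact: is_derive_expR. Qed.

Lemma has_deriv_exp_lin k c :
  has_deriv (fun t => expR (k * (t - c))) (fun t => k * expR (k * (t - c))).
Proof.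
apply: has_deriv_ext.
  apply: (has_deriv_comp has_deriv_expR).
  apply: has_derivZ; apply: has_derivB; [exact: has_deriv_id|exact: has_deriv_cst].
by move=> t /=; rewrite subr0 mulr1 mulrC.
Qed.

Lemma has_deriv_exp2 : has_deriv (fun t => expR (2 * t)) (fun t => 2 * expR (2 * t)).
Proof.
apply: has_deriv_ext.
  by apply: (has_deriv_comp has_deriv_expR); apply: has_derivZ; exact: has_deriv_id.
by move=> t /=; rewrite mulr1 mulrC.
Qed.

Lemma has_deriv_continuous F f : has_deriv F f -> continuous F.
Proof.
move=> Ff t; apply: differentiable_continuous; apply/derivable1_diffP.
by have [] := Ff t.
Qed.

Lemma has_deriv_MVT F f a b : has_deriv F f -> a <= b ->
  exists2 c, a <= c <= b & F b - F a = f c * (b - a).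
Proof.
move=> Ff ab.
have [c] := @MVT_segment _ F f a b ab (fun x _ => Ff x)
  (continuous_subspaceT (has_deriv_continuous Ff)).
by rewrite in_itv /= => cab ->; exists c.
Qed.

Lemma has_deriv_le F G f g a b : has_deriv F f -> has_deriv G g -> a <= b ->
  (forall t, a <= t <= b -> f t <= g t) -> F b - F a <= G b - G a.
Proof.
move=> Ff Gg ab fg.
have [c cab] := has_deriv_MVT (has_derivB Gg Ff) ab.
have := fg _ cab; rewrite -subr_ge0 => h1 h2.
have : 0 <= (g c - f c) * (b - a) by rewrite mulr_ge0 ?subr_ge0 // -subr_ge0.
by rewrite -h2; lra.
Qed.

Lemma has_deriv_abs_le F G f g a b : has_deriv F f -> has_deriv G g -> a <= b ->
  (forall t, a <= t <= b -> `|f t| <= g t) -> `|F b - F a| <= G b - G a.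
Proof.
move=> Ff Gg ab fg; rewrite ler_norml; apply/andP; split.
- have := has_deriv_le (has_derivN Gg) Ff ab.
  have -> : - G b - - G a = - (G b - G a) by ring.
  by apply=> t /fg; rewrite ler_norml => /andP[].
- by apply: has_deriv_le Ff Gg ab _ => t /fg; rewrite ler_norml => /andP[].
Qed.

Lemma has_deriv_ge0 F f a b : has_deriv F f -> a <= b ->
  (forall t, a <= t <= b -> 0 <= f t) -> F a <= F b.
Proof.
move=> Ff ab f0; rewrite -subr_ge0.
by have := has_deriv_le (has_deriv_cst 0) Ff ab f0; rewrite subr0.
Qed.

Lemma has_deriv_lip F f K a b : has_deriv F f -> (forall t, `|f t| <= K) ->
  `|F b - F a| <= K * `|b - a|.
Proof.
move=> Ff fK.
have H s t : s <= t -> `|F t - F s| <= K * (t - s).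
  move=> st.
  have := has_deriv_abs_le Ff (has_derivZ K (@has_deriv_id)) st.
  by rewrite -mulrBr; apply => u _; rewrite mulr1.
have [ab|/ltW ba] := leP a b.
  by rewrite (ger0_norm (_ : 0 <= b - a)) ?subr_ge0 ?H.
by rewrite distrC (distrC b) (ger0_norm (_ : 0 <= a - b)) ?subr_ge0 ?H.
Qed.

Lemma has_deriv_taylor1 F f f' C s t : has_deriv F f -> has_deriv f f' ->
  (forall u, `|f' u| <= C) -> `|F t - F s - f s * (t - s)| <= C * `|t - s| ^+ 2.
Proof.
move=> Ff ff' fC.
have C0 : 0 <= C by exact: le_trans (normr_ge0 _) (fC 0).
pose H (x : R) : R := F x - f s * x.
have dH : has_deriv H (fun x => f x - f s).
  apply: has_deriv_ext (has_derivB Ff (has_derivZ (f s) has_deriv_id)) _ => x.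
  by rewrite mulr1.
have -> : F t - F s - f s * (t - s) = H t - H s by rewrite /H; ring.
have key x := has_deriv_lip s x ff' fC.
have [st|/ltW st] := leP s t.
  have [c /andP[c1 c2] ->] := has_deriv_MVT dH st.
  rewrite normrM expr2 mulrA ler_wpM2r //; apply: le_trans (key c) _.
  by rewrite ler_wpM2l // !ger0_norm ?subr_ge0 //; lra.
have [c /andP[c1 c2] E] := has_deriv_MVT dH st.
rewrite distrC E normrM expr2 mulrA (distrC t) ler_wpM2r //; apply: le_trans (key c) _.
by rewrite ler_wpM2l // (distrC c) !ger0_norm ?subr_ge0 //; lra.
Qed.

Lemma lipschitz_continuous (f : R -> R) K : (forall s t, `|f t - f s| <= K * `|t - s|) ->
  continuous f.
Proof.
move=> fK s; apply/cvgrPdist_lt => e e0.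
have K1 : 0 < `|K| + 1 by have := normr_ge0 K; lra.
have de : 0 < e / (`|K| + 1) by rewrite divr_gt0.
have nb : \forall t \near s, ball s (e / (`|K| + 1)) t by exact: nbhsx_ballx.
near=> t.
have h : `|s - t| < e / (`|K| + 1) by near: t; exact: nb.
apply: le_lt_trans (fK _ _) _; rewrite ltr_pdivlMr // mulrC in h.
apply: le_lt_trans h; rewrite ler_wpM2r //; have := ler_norm K; lra.
Unshelve. all: by end_near.
Qed.

Lemma has_deriv_eq F G f a b : has_deriv F f -> has_deriv G f ->
  F b - F a = G b - G a.
Proof.
move=> Ff Gf.
have := @is_derive_0_is_cst R (fun t => F t - G t) a b.
move=> H; suff: F a - G a = F b - G b by lra.
apply: H => t; have := has_derivB Ff Gf t.
by rewrite subrr.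
Qed.

(* [h] dominates [f] because [h - f] is convex and has a double zero at [c]. *)
Lemma second_order_comparison f f1 f2 h h1 h2 c :
  has_deriv f f1 -> has_deriv f1 f2 -> has_deriv h h1 -> has_deriv h1 h2 ->
  f c = 0 -> f1 c = 0 -> h1 c = 0 -> (forall t, `|f2 t| <= h2 t) ->
  forall t, `|f t| <= h t - h c.
Proof.
move=> ff1 f12 hh1 h12 fc f1c h1c fh t.
have key g g1 g2 : has_deriv g g1 -> has_deriv g1 g2 ->
    g1 c = 0 -> (forall t, 0 <= g2 t) -> g c <= g t.
  move=> gg1 g12 g1c g20.
  have [ct|/ltW tc] := leP c t.
    apply: (has_deriv_ge0 gg1 ct) => s /andP[cs _].
    by rewrite -g1c; apply: (has_deriv_ge0 g12 cs).
  rewrite -lerN2; apply: (has_deriv_ge0 (has_derivN gg1) tc) => s /andP[_ sc].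
  by rewrite oppr_ge0 -g1c; apply: (has_deriv_ge0 g12 sc).
have := key _ _ _ (has_derivB hh1 ff1) (has_derivB h12 f12).
have := key _ _ _ (has_derivD hh1 ff1) (has_derivD h12 f12).
rewrite fc f1c h1c subr0 !addr0 => k1 k2.
rewrite ler_norml; apply/andP; split.
  suff: h c <= h t + f t by lra.
  by apply: k1 => // u; have := fh u; rewrite ler_norml => /andP[]; lra.
suff: h c <= h t - f t by lra.
by rewrite -[h c]subr0; apply: k2 => // u; have := fh u; rewrite ler_norml => /andP[]; lra.
Qed.

(** The fundamental theorem gives an antiderivative only to the right of a chosen left end [- n].
    The pieces are glued over growing [n]; subtracting the value at 0 makes them independent of
    [n]. *)
Lemma continuous_has_deriv f : continuous f -> exists F, has_deriv F f.
Proof.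
move=> cf; pose mu := @lebesgue_measure R.
have intf a b : mu.-integrable `[a, b] (EFin \o f).
  apply: continuous_compact_integrable; first exact: segment_compact.
  exact: continuous_subspaceT.
pose P (n : nat) (x : R) : R := (\int[mu]_(t in `[- n%:R, x]) f t)%R.
have dP (n : nat) (x : R) : - n%:R < x -> is_derive x (1 : R) (P n) (f x).
  move=> nx.
  have [dF Fx] := @continuous_FTC1 R f (BLeft (- n%:R)) x (x + 1)
    (ltr_pwDr ltr01 (lexx x)) (intf _ _) nx (cf x).
  by split; [exact: dF|rewrite -derive1E; exact: Fx].
pose F (x : R) : R := P (Num.truncn `|x|).+1 x - P (Num.truncn `|x|).+1 0.
have PE (n m : nat) (x : R) : - n%:R < x -> - m%:R < x -> (0 < n)%N -> (0 < m)%N ->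
    P n x - P n 0 = P m x - P m 0.
  wlog nm : n m / (n <= m)%N => [H|] nx mx n0 m0.
    by have [nm|/ltnW mn] := leqP n m; [exact: H|exact/esym/H].
  have key (y : R) : - n%:R < y -> P m y - P n y = P m (- n%:R).
    move=> ny.
    have nm' : - (m%:R : R) <= - n%:R by rewrite lerN2 ler_nat.
    have := @Rintegral_itvB R f (BLeft (- m%:R)) (BRight y) (- n%:R) (intf _ _).
    rewrite !bnd_simp => /(_ nm' (ltW ny)).
    rewrite Rintegral_itv_obnd_cbnd; last first.
      by apply: integrableS (intf (- n%:R) y) => //; apply: subset_itvr; rewrite bnd_simp.
    by rewrite /P; lra.
  have n00 : - (n%:R : R) < 0 by rewrite oppr_lt0 ltr0n.
  by have := key x nx; have := key 0 n00; lra.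
exists F => x.
(* One more than the index chosen in [F x]: the points [y] with [|y| < N - 1] form a neighbourhood
   of [x] on which the single piece [P N] represents [F]. *)
pose N := (Num.truncn `|x|).+2.
have xN : `|x| < N.-1%:R by exact: truncnS_gt.
have Nx (y : R) (m : nat) : `|y| < m%:R -> - m%:R < y by rewrite ltr_norml => /andP[].
have := dP N x _; have Nx' : - N%:R < x by apply: Nx; apply: lt_le_trans xN _; rewrite ler_nat.
move=> /(_ Nx') dPx.
have := is_deriveB dPx (is_derive_cst (P N 0) x (1 : R)); rewrite subr0.
apply: near_eq_is_derive.
have : \forall y \near x, `|y| < N.-1%:R.
  by apply: (@cvgr_norm_lt R R R (nbhs x) _ id x); [exact: cvg_id|exact: xN].
apply: filterS => y yN; rewrite /F.
apply: PE => //; apply: Nx.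
  by apply: lt_le_trans yN _; rewrite ler_nat.
exact: truncnS_gt.
Qed.

End Calculus.

(** * Global solutions of a second-order equation *)

Section ODE.
Variable R : realType.

Lemma le_exp2_eq0 (x C : R) : (forall n, `|x| <= C / 2 ^+ n) -> x = 0.
Proof.
move=> H; apply/eqP/negPn/negP => x0.
have x_gt0 : 0 < `|x| by rewrite normr_gt0.
have [n Cn] : exists n : nat, C / `|x| < n%:R.
  by exists (Num.truncn (C / `|x|)).+1; exact: truncnS_gt.
have := H n; rewrite ler_pdivlMr ?exprn_gt0 // => Hn.
move: Cn; rewrite ltr_pdivrMr // => Cn.
have : C < `|x| * 2 ^+ n.
  apply: lt_le_trans Cn _; rewrite mulrC ler_wpM2l //.
  by rewrite -natrX ler_nat ltnW // ltn_expl.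
by lra.
Qed.

Lemma geometric_limit (x : nat -> R) (e : R) : 0 <= e ->
  (forall n, `|x n.+1 - x n| <= e / 2 ^+ n) ->
  exists l, forall n, `|l - x n| <= 2 * e / 2 ^+ n.
Proof.
move=> e0 dx.
have p2 n : 0 < 2 ^+ n :> R by rewrite exprn_gt0.
have mono m k : `|x (m + k)%N - x m| <= 2 * e / 2 ^+ m - 2 * e / 2 ^+ (m + k).
  elim: k => [|k IH]; first by rewrite addn0 !subrr normr0.
  rewrite addnS.
  have -> : x (m + k).+1 - x m = (x (m + k).+1 - x (m + k)%N) + (x (m + k)%N - x m) by ring.
  apply: le_trans (ler_normD _ _) _.
  have -> : 2 * e / 2 ^+ (m + k).+1 = e / 2 ^+ (m + k).
    by rewrite exprS; field; rewrite gt_eqF.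
  have := dx (m + k)%N; move: IH.
  have -> : 2 * e / 2 ^+ (m + k) = 2 * (e / 2 ^+ (m + k)) by rewrite mulrA.
  lra.
have ge0 n : 0 <= 2 * e / 2 ^+ n by rewrite divr_ge0 // ?mulr_ge0 // ltW.
have far m n : `|x n - x m| <= 2 * e / 2 ^+ m + 2 * e / 2 ^+ n.
  have [mn|/ltnW nm] := leqP m n.
    by have := mono m (n - m)%N; rewrite subnKC //; have := ge0 n; lra.
  by have := mono n (m - n)%N; rewrite subnKC // distrC; have := ge0 m; lra.
(* The term minus its geometric tail is a lower bound for every term plus its tail, so the supremum
   of these lower bounds is the limit, with the stated rate. *)
pose S := [set x n - 2 * e / 2 ^+ n | n in [set: nat]].
have ubS m : ubound S (x m + 2 * e / 2 ^+ m).
  move=> _ [n _ <-]; have := far m n; rewrite ler_norml => /andP[_]; lra.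
have S0 : S !=set0 by exists (x 0%N - 2 * e / 2 ^+ 0), 0%N.
exists (sup S) => n; rewrite ler_norml; apply/andP; split.
  suff: x n - 2 * e / 2 ^+ n <= sup S by lra.
  by apply: ub_le_sup; [exists (x 0%N + 2 * e / 2 ^+ 0); exact: ubS|exists n].
suff: sup S <= x n + 2 * e / 2 ^+ n by lra.
exact: ge_sup.
Qed.

(** Picard iteration measured against the weight [E], which satisfies [E'' = l^2 E]. Integrating
    twice then gains a factor [l^-2] on the whole line at once, so no continuation of local
    solutions is needed. *)
Lemma ode_global_solution (K : R -> R -> R) (B0 B c p : R) : 0 <= B ->
  (forall s t, `|K s t| <= B0) ->
  (forall s s' t, `|K s t - K s' t| <= B * `|s - s'|) ->
  (forall y : R -> R, continuous y -> continuous (fun t => K (y t) t)) ->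
  exists y z : R -> R, [/\ has_deriv y z, has_deriv z (fun t => K (y t) t),
    y c = 0 & z c = p].
Proof.
move=> B_ge0 Kb Klip Kc.
pose sol (y : R -> R) (yz : (R -> R) * (R -> R)) := [/\ has_deriv yz.1 yz.2,
  has_deriv yz.2 (fun t => K (y t) t), yz.1 c = 0 & yz.2 c = p].
(* The Picard map is made total: a discontinuous [y] gets a dummy image, and only continuous
   functions are ever iterated. *)
have step y : {yz | continuous y -> sol y yz}.
  have [cy|ncy] := pselect (continuous y); last by exists (y, y).
  apply: cid.
  have [Z dZ] := continuous_has_deriv (Kc _ cy).
  pose z (t : R) : R := Z t - (Z c - p).
  have dz : has_deriv z (fun t => K (y t) t).
    apply: has_deriv_ext (has_derivB dZ (has_deriv_cst (Z c - p))) _ => t.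
    by rewrite subr0.
  have [Y dY] := continuous_has_deriv (has_deriv_continuous dz).
  exists ((fun t => Y t - Y c), z) => _; split => //=.
  - by apply: has_deriv_ext (has_derivB dY (has_deriv_cst (Y c))) _ => t; rewrite subr0.
  - by rewrite subrr.
  - by rewrite /z; ring.
pose T y := (sval (step y)).1; pose T' y := (sval (step y)).2.
have TP y : continuous y -> sol y (T y, T' y).
  by move=> cy; have := svalP (step y) cy; rewrite /T /T'; case: (sval _).
have cT y : continuous y -> continuous (T y).
  by move=> /TP[/= d _ _ _]; exact: has_deriv_continuous d.
(* This choice gives [2 B <= l^2], hence contraction by the factor 1/2. *)
pose l := B + 1; have l0 : 0 < l by rewrite /l; lra.
pose E (t : R) : R := expR (l * (t - c)) + expR (- l * (t - c)).
pose E1 (t : R) : R := l * expR (l * (t - c)) + - l * expR (- l * (t - c)).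
have dE : has_deriv E E1 by apply: has_derivD; exact: has_deriv_exp_lin.
have dE1 : has_deriv E1 (fun t => l ^+ 2 * E t).
  apply: has_deriv_ext.
    by apply: has_derivD; apply: has_derivZ; exact: has_deriv_exp_lin.
  by move=> t /=; rewrite /E; ring.
have Ec : E c = 2 by rewrite /E subrr !mulr0 expR0.
have E1c : E1 c = 0 by rewrite /E1 subrr !mulr0 expR0; ring.
have E2 t : 2 <= E t.
  rewrite /E mulNr expRN; set x := expR _.
  have x0 : 0 < x by exact: expR_gt0.
  have -> : x + x^-1 = 2 + (x - 1) ^+ 2 / x by field; rewrite gt_eqF.
  by rewrite lerDl divr_ge0 ?sqr_ge0 // ltW.
have E0 t : 0 <= E t by have := E2 t; lra.
have contr y1 y2 M : 0 <= M -> continuous y1 -> continuous y2 ->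
    (forall t, `|K (y1 t) t - K (y2 t) t| <= M * l ^+ 2 * E t) ->
    forall t, `|T y1 t - T y2 t| <= M * E t.
  move=> M0 /TP[/= a1 a2 a3 a4] /TP[/= b1 b2 b3 b4] H t.
  have := second_order_comparison (has_derivB a1 b1) (has_derivB a2 b2)
    (has_derivZ M dE) (has_derivZ M dE1).
  move=> /(_ c); rewrite a3 b3 a4 b4 !subrr E1c mulr0 Ec.
  move=> /(_ erefl erefl erefl) HH; apply: le_trans (HH _ t) _ => [s|].
    by rewrite mulrA; exact: H.
  by lra.
have contrL y1 y2 M : 0 <= M -> continuous y1 -> continuous y2 ->
    (forall t, `|y1 t - y2 t| <= 2 * M * E t) ->
    forall t, `|T y1 t - T y2 t| <= M * E t.
  move=> M0 c1 c2 H; apply: contr => // t.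
  apply: le_trans (Klip _ _ _) _.
  apply: le_trans (_ : B * (2 * M * E t) <= _); first by rewrite ler_wpM2l.
  have -> : B * (2 * M * E t) = 2 * B * (M * E t) by ring.
  have -> : M * l ^+ 2 * E t = l ^+ 2 * (M * E t) by ring.
  by rewrite ler_wpM2r ?mulr_ge0 // /l; nra.
(* The sequence starts at the image of 0, so that the iterates start from a function already solving
   the initial conditions. *)
pose y n := iter n T (T (fun=> 0)).
have cy n : continuous (y n).
  elim: n => [|n IH] /=; last exact: cT.
  by apply: cT => t; exact: cvg_cst.
have B00 : 0 <= B0 by apply: le_trans (Kb 0 0).
(* Two values of [K] differ by at most [2 B0 <= B0 E], because [E >= 2]; this bounds the first
   Picard step by [e E]. *)
pose e := B0 / l ^+ 2.
have e0 : 0 <= e by rewrite divr_ge0 // sqr_ge0.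
have dy n t : `|y n.+1 t - y n t| <= e * E t / 2 ^+ n.
  have -> : e * E t / 2 ^+ n = e / 2 ^+ n * E t by ring.
  elim: n t => [|n IH] t.
    rewrite expr0 divr1 /=; apply: contr => //; first exact: (cy 0%N).
      by move=> s; exact: cvg_cst.
    move=> s; rewrite /e divfK ?expf_neq0 ?gt_eqF //.
    apply: le_trans (ler_normB _ _) _.
    have := Kb (T (fun=> 0) s) s; have := Kb 0 s; have := E2 s.
    by move=> ? ? ?; apply: le_trans (_ : B0 * 2 <= _); [lra|rewrite ler_wpM2l].
  apply: contrL => //; first by rewrite divr_ge0 // exprn_ge0.
  - exact: (cy n.+1).
  - move=> s; apply: le_trans (IH s) _; rewrite exprS ler_wpM2r //.
    rewrite le_eqVlt; apply/orP; left; apply/eqP.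
    by field; rewrite expf_neq0.
have /choice[Y YP] : forall t, exists l, forall n, `|l - y n t| <= 2 * (e * E t) / 2 ^+ n.
  move=> t; apply: geometric_limit; first exact: mulr_ge0.
  by move=> n; exact: dy.
have cY : continuous Y.
  move=> t; apply/cvgrPdist_lt => eps eps0.
  pose M := e * (E t + 1).
  have M0 : 0 <= M by rewrite mulr_ge0 // addr_ge0.
  have [n Mn] : exists n, 2 * M / 2 ^+ n < eps / 3.
    apply/not_existsP => H; have := @le_exp2_eq0 (eps / 3) (2 * M).
    have eps3 : 0 < eps / 3 by rewrite divr_gt0.
    rewrite (gtr0_norm eps3) => HH.
    have : eps / 3 = 0 by apply: HH => k; rewrite leNgt; apply/negP; exact: H.
    by move=> h; move: eps3; rewrite h ltxx.
  have P (s : R) : E s < E t + 1 -> `|Y s - y n s| < eps / 3.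
    move=> Es; apply: le_lt_trans (YP _ _) _; apply: le_lt_trans Mn.
    rewrite ler_wpM2r ?invr_ge0 ?exprn_ge0 // ler_wpM2l // /M ler_wpM2l //.
    exact: ltW.
  have nE : \forall s \near nbhs (t : R), E s < E t + 1.
    have cE : continuous E by exact: has_deriv_continuous dE.
    have := cE t; move=> /cvgrPdist_lt /(_ 1 ltr01).
    by apply: filterS => s; rewrite ltr_norml => /andP[]; lra.
  have := cy n t; move=> /cvgrPdist_lt /(_ (eps / 3) (divr_gt0 eps0 (ltr0Sn _ 2))) ny.
  near=> s.
  have h1 := P t (ltr_pwDr ltr01 (lexx _)).
  have h2 : `|Y s - y n s| < eps / 3 by apply: P; near: s.
  have h3 : `|y n t - y n s| < eps / 3 by near: s.
  have -> : Y t - Y s = (Y t - y n t) + (y n t - y n s) + (y n s - Y s) by ring.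
  apply: le_lt_trans (ler_normD _ _) _.
  apply: le_lt_trans (lerD (ler_normD _ _) (lexx _)) _.
  by rewrite (distrC (y n s)); lra.
have TY t : T Y t = Y t.
  apply/eqP; rewrite -subr_eq0; apply/eqP.
  apply: (@le_exp2_eq0 _ (2 * (e * E t))) => n.
  have h1 : `|T Y t - y n.+1 t| <= e / 2 ^+ n * E t.
    apply: contrL => //; first by rewrite divr_ge0 // exprn_ge0.
    move=> s; have := YP s n.
    by have -> : 2 * (e * E s) / 2 ^+ n = 2 * (e / 2 ^+ n) * E s by ring.
  have h2 := YP t n.+1.
  have -> : T Y t - Y t = (T Y t - y n.+1 t) + (y n.+1 t - Y t) by ring.
  apply: le_trans (ler_normD _ _) _; rewrite (distrC (y _ _)).
  have h3 : 2 * (e * E t) / 2 ^+ n.+1 = e / 2 ^+ n * E t.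
    by rewrite exprS; field; rewrite expf_neq0.
  have -> : 2 * (e * E t) / 2 ^+ n = e / 2 ^+ n * E t + e / 2 ^+ n * E t by ring.
  by rewrite h3 in h2; lra.
have [/= a1 a2 a3 a4] := TP _ cY.
have TYE : T Y = Y by apply/funext.
by exists Y, (T' Y); rewrite TYE in a1 a3.
Unshelve. all: by end_near.
Qed.

End ODE.

(** * Algebras of functions closed under differentiation *)

Section Smooth.
Variable R : realType.

(** The algebra generated by [S]. Smoothness asks for all iterated directional derivatives; they
    need not be computed once they are known to stay in one such algebra. *)
Inductive alg (T : Type) (S : set (T -> R)) : (T -> R) -> Prop :=
| alg_gen f : S f -> alg S f
| alg_cst c : alg S (fun=> c)
| alg_add f g : alg S f -> alg S g -> alg S (fun x => f x + g x)
| alg_mul f g : alg S f -> alg S g -> alg S (fun x => f x * g x).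

Lemma alg_mono (T : Type) (S S' : set (T -> R)) f : S `<=` S' -> alg S f -> alg S' f.
Proof.
move=> SS'; elim=> {f} [f /SS'|c|f g _ IHf _ IHg|f g _ IHf _ IHg].
- exact: alg_gen.
- exact: alg_cst.
- exact: alg_add.
- exact: alg_mul.
Qed.

Lemma alg_opp (T : Type) (S : set (T -> R)) f : alg S f -> alg S (fun x => - f x).
Proof.
move=> Sf; have := alg_mul (alg_cst S (-1)) Sf.
by congr alg; apply/funext => x; rewrite mulN1r.
Qed.

Section SmoothOn.
Variables (W : normedModType R) (U : set W) (S : set (W -> R)).
Hypothesis oU : open U.
Hypothesis Scont : forall f, S f -> forall x, U x -> {for x, continuous f}.
Hypothesis Sder : forall f, S f -> forall v, exists2 g, alg S g &
  forall x, U x -> is_derive x v f (g x).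

Lemma alg_continuous f : alg S f -> forall x, U x -> {for x, continuous f}.
Proof.
elim=> {f} [f Sf|c|f g _ IHf _ IHg|f g _ IHf _ IHg] x Ux.
- exact: Scont.
- exact: cvg_cst.
- by apply: cvgD; [exact: IHf|exact: IHg].
- by apply: cvgM; [exact: IHf|exact: IHg].
Qed.

Lemma alg_derive f : alg S f -> forall v, exists2 g, alg S g &
  forall x, U x -> is_derive x v f (g x).
Proof.
elim=> {f} [f Sf|c|f g Sf IHf Sg IHg|f g Sf IHf Sg IHg] v.
- exact: Sder.
- by exists (fun=> 0); [exact: alg_cst|move=> x _; exact: is_derive_cst].
- have [f' Sf' df] := IHf v; have [g' Sg' dg] := IHg v.
  exists (fun x => f' x + g' x); first exact: alg_add.
  by move=> x Ux; apply: is_deriveD; [exact: df|exact: dg].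
- have [f' Sf' df] := IHf v; have [g' Sg' dg] := IHg v.
  exists (fun x => f x * g' x + g x * f' x); first by apply: alg_add; exact: alg_mul.
  by move=> x Ux; apply: is_deriveM; [exact: df|exact: dg].
Qed.

(** Each iterated derivative agrees on [U] with a member of the algebra. The agreement holds on [U]
    only, and openness of [U] lets it be differentiated again. *)
Lemma alg_smooth_on f : alg S f -> smooth_on U f.
Proof.
move=> Sf vs.
have [g Sg gf] : exists2 g, alg S g & forall x, U x -> iderive vs f x = g x.
  elim: vs => [|v vs [g Sg gf]] /=; first by exists f.
  have [g' Sg' dg] := alg_derive Sg v.
  exists g' => // x Ux.
  have -> : 'D_v (iderive vs f) x = 'D_v g x.
    apply: near_eq_derive; near=> y; apply: gf; near: y.
    exact: open_nbhs_nbhs.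
  by have [_ ->] := dg x Ux.
move=> x Ux.
have nfg : \forall y \near x, g y = iderive vs f y.
  by near=> y; apply/esym/gf; near: y; exact: open_nbhs_nbhs.
split=> [v|].
  have [g' Sg' dg] := alg_derive Sg v.
  by have [] := near_eq_is_derive nfg (dg x Ux).
have := alg_continuous Sg Ux; rewrite /prop_for /continuous_at -gf //.
by apply: cvg_trans; exact: near_eq_cvg nfg.
Unshelve. all: by end_near.
Qed.

End SmoothOn.

Definition diff_closed (S : set (R -> R)) :=
  forall f, S f -> exists2 g, alg S g & has_deriv f g.

(** Smoothness witnessed by a differential algebra containing [f]. Sums and products are handled by
    uniting generators, and a solution of an equation by adjoining its derivative and the
    coefficients. *)
Definition smooth1 (f : R -> R) := exists2 S, diff_closed S & alg S f.

Lemma diff_closed_alg S : diff_closed S ->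
  forall f, alg S f -> exists2 g, alg S g & has_deriv f g.
Proof.
move=> dS f; elim=> {f} [f Sf|c|f g Sf [f' Sf' df] Sg [g' Sg' dg]|f g Sf [f' Sf' df] Sg [g' Sg' dg]].
- exact: dS.
- by exists (fun=> 0); [exact: alg_cst|exact: has_deriv_cst].
- by exists (fun x => f' x + g' x); [exact: alg_add|exact: has_derivD].
- exists (fun x => f' x * g x + f x * g' x); last exact: has_derivM.
  by apply: alg_add; exact: alg_mul.
Qed.

Lemma smooth1_deriv f : smooth1 f -> exists2 g, smooth1 g & has_deriv f g.
Proof.
by move=> [S dS] /(diff_closed_alg dS)[g Sg dg]; exists g => //; exists S.
Qed.

Lemma diff_closedU S S' : diff_closed S -> diff_closed S' -> diff_closed (S `|` S').
Proof.
move=> dS dS' f [/dS|/dS'] [g Sg dg]; exists g => //; move: Sg.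
  by apply: alg_mono => h; left.
by apply: alg_mono => h; right.
Qed.

Lemma smooth1D f g : smooth1 f -> smooth1 g -> smooth1 (fun t => f t + g t).
Proof.
move=> [S dS Sf] [S' dS' Sg]; exists (S `|` S'); first exact: diff_closedU.
by apply: alg_add; [apply: alg_mono Sf => h; left|apply: alg_mono Sg => h; right].
Qed.

Lemma smooth1M f g : smooth1 f -> smooth1 g -> smooth1 (fun t => f t * g t).
Proof.
move=> [S dS Sf] [S' dS' Sg]; exists (S `|` S'); first exact: diff_closedU.
by apply: alg_mul; [apply: alg_mono Sf => h; left|apply: alg_mono Sg => h; right].
Qed.

Lemma smooth1_cst c : smooth1 (fun=> c).
Proof. by exists set0; [|exact: alg_cst]. Qed.

Lemma smooth1_id : smooth1 id.
Proof.
exists [set id]; last exact: alg_gen.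
by move=> _ ->; exists (fun=> 1); [exact: alg_cst|exact: has_deriv_id].
Qed.

Lemma smooth1_exp_lin k : smooth1 (fun t => expR (k * t)).
Proof.
pose f (t : R) := expR (k * t).
exists [set f]; last exact: alg_gen.
move=> _ ->; exists (fun t => k * f t).
  by apply: alg_mul; [exact: alg_cst|exact: alg_gen].
have := has_deriv_exp_lin k 0; rewrite /f; congr has_deriv; apply/funext => t; by rewrite subr0.
Qed.

Lemma smooth1_continuous f : smooth1 f -> continuous f.
Proof. by move=> /smooth1_deriv[g _]; exact: has_deriv_continuous. Qed.

End Smooth.

(** * Radial functions *)

Section Radial.
Variable R : realType.

(** Directional derivatives are ordinary derivatives along lines, which makes the one-variable rules
    available without total differentiability. *)
Lemma line_is_derive (W : normedModType R) (f : W -> R) (x v : W) (df : R) :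
  is_derive (0 : R) (1 : R) (fun h : R => f (h *: v + x)) df -> is_derive x v f df.
Proof.
move=> [d e]; split; first exact: (proj2 (derivable1P f x v) d).
have E : (fun h : R => h^-1 *: (((fun h : R => f (h *: v + x)) \o shift 0) (h *: (1 : R)) -
    f (0 *: v + x))) = (fun h : R => h^-1 *: ((f \o shift x) (h *: v) - f x)).
  by apply/funext => h /=; rewrite scale0r add0r addr0 /GRing.scale /= mulr1.
by rewrite -e /derive E.
Qed.

Lemma derivable_line (W : normedModType R) (f : W -> R) (x v : W) (h0 : R) :
  derivable f (h0 *: v + x) v ->
  is_derive h0 (1 : R) (fun h : R => f (h *: v + x)) ('D_v f (h0 *: v + x)).
Proof.
move=> df.
have E : (fun h : R => h^-1 *: (((fun h : R => f (h *: v + x)) \o shift h0) (h *: (1 : R)) -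
    f (h0 *: v + x))) = (fun h : R => h^-1 *: ((f \o shift (h0 *: v + x)) (h *: v) - f (h0 *: v + x))).
  apply/funext => h /=; congr (_ *: (f _ - _)).
  have -> : h *: (1 : R) = h by exact: mulr1.
  by rewrite scalerDl addrA.
by split; rewrite /derivable /derive E.
Qed.

(** This is [ln |x|]; taking half the logarithm of the square avoids a square root. *)
Definition tau (x : R * R) : R := ln (sqnorm2 x) / 2.

Lemma sqnorm2_ge0 (x : R * R) : 0 <= sqnorm2 x.
Proof. by rewrite addr_ge0 // sqr_ge0. Qed.

Lemma sqnorm2_gt0 (x : R * R) : (0 < sqnorm2 x) = (x != 0).
Proof.
rewrite lt_neqAle sqnorm2_ge0 andbT eq_sym /sqnorm2 paddr_eq0 ?sqr_ge0 //.
by rewrite !sqrf_eq0; case: x.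
Qed.

Lemma expR_tau (x : R * R) : x != 0 -> expR (2 * tau x) = sqnorm2 x.
Proof.
by rewrite -sqnorm2_gt0 => x0; rewrite /tau mulrC divfK ?pnatr_eq0 // lnK.
Qed.

Lemma expRN_tau (x : R * R) : x != 0 -> expR (- 2 * tau x) = (sqnorm2 x)^-1.
Proof. by move=> x0; rewrite mulNr expRN expR_tau. Qed.

Lemma is_derive_fst (x v : R * R) : is_derive x v fst v.1.
Proof.
apply: line_is_derive => /=.
have := has_derivD (has_derivM (@has_deriv_id R) (has_deriv_cst v.1)) (has_deriv_cst x.1) 0.
by rewrite mul1r mulr0 !addr0.
Qed.

Lemma is_derive_snd (x v : R * R) : is_derive x v snd v.2.
Proof.
apply: line_is_derive => /=.
have := has_derivD (has_derivM (@has_deriv_id R) (has_deriv_cst v.2)) (has_deriv_cst x.2) 0.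
by rewrite mul1r mulr0 !addr0.
Qed.

Lemma is_derive_sqnorm2 (x v : R * R) :
  is_derive x v (@sqnorm2 R) (2 * (x.1 * v.1 + x.2 * v.2)).
Proof.
have := is_deriveD (is_deriveM (is_derive_fst x v) (is_derive_fst x v))
  (is_deriveM (is_derive_snd x v) (is_derive_snd x v)).
have -> : fst * fst + snd * snd = @sqnorm2 R :> (R * R -> R).
  by apply/funext => y; rewrite /sqnorm2 !expr2.
by move=> H; apply: (is_derive_eq H); rewrite /GRing.scale /=; ring.
Qed.

Lemma is_derive_comp_line (f : R -> R) (g : R * R -> R) x v df dg :
  is_derive (g x) (1 : R) f df -> is_derive x v g dg ->
  is_derive x v (f \o g) (df * dg).
Proof.
move=> Hf [dg1 dg2]; apply: line_is_derive.
have dgl : is_derive (0 : R) (1 : R) (fun h : R => g (h *: v + x)) dg.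
  have := @derivable_line _ g x v 0; rewrite scale0r add0r dg2; exact.
apply: (@is_derive1_comp R f (fun h : R => g (h *: v + x)) 0 df dg) => //.
by rewrite scale0r add0r.
Qed.

Lemma is_derive_tau (x v : R * R) : x != 0 ->
  is_derive x v tau ((x.1 * v.1 + x.2 * v.2) / sqnorm2 x).
Proof.
move=> x0.
have s0 : 0 < sqnorm2 x by rewrite sqnorm2_gt0.
have H1 : is_derive (sqnorm2 x) (1 : R) (fun s => ln s / 2) ((sqnorm2 x)^-1 / 2).
  have := is_deriveM (is_derive1_ln s0) (is_derive_cst (2^-1 : R) (sqnorm2 x) (1 : R)).
  by move=> H; apply: (is_derive_eq H); rewrite /GRing.scale /=; ring.
have := is_derive_comp_line H1 (is_derive_sqnorm2 x v).
by move=> H; apply: (is_derive_eq H); field; rewrite gt_eqF.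
Qed.

Lemma is_derive_radial (G g : R -> R) (x v : R * R) : has_deriv G g -> x != 0 ->
  is_derive x v (G \o tau) (g (tau x) * ((x.1 * v.1 + x.2 * v.2) / sqnorm2 x)).
Proof. by move=> Gg x0; apply: is_derive_comp_line (Gg _) (is_derive_tau v x0). Qed.

Lemma continuous_sqnorm2 : continuous (@sqnorm2 R).
Proof.
move=> x; rewrite /sqnorm2; apply: cvgD; apply: cvgM; try exact: cvg_fst; exact: cvg_snd.
Qed.

Lemma continuous_tau (x : R * R) : x != 0 -> {for x, continuous tau}.
Proof.
move=> x0; apply: cvgM; last exact: cvg_cst.
apply: continuous_comp; first exact: continuous_sqnorm2.
by apply: continuous_ln; rewrite sqnorm2_gt0.
Qed.

Definition punctured : set (R * R) := [set x | x != 0].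

Lemma open_punctured : open punctured.
Proof.
have -> : punctured = @sqnorm2 R @^-1` [set s | 0 < s].
  by apply/seteqP; split=> x /=; rewrite /punctured /= sqnorm2_gt0.
by apply: open_comp => [x _|]; [exact: continuous_sqnorm2|exact: open_gt].
Qed.

(** The coordinates must be adjoined because differentiating [G o tau] produces [x . v / |x|^2]. The
    denominator adds nothing new: it is [e^(-2 t)] at [t = tau x], again radial. *)
Definition radial_gen : set (R * R -> R) :=
  [set f | f = fst \/ f = snd \/ exists2 G, smooth1 G & f = G \o tau].

Lemma radial_gen_continuous f : radial_gen f -> forall x, punctured x -> {for x, continuous f}.
Proof.
move=> [->|[->|[G sG ->]]] x x0; [exact: cvg_fst|exact: cvg_snd|].
by apply: continuous_comp; [exact: continuous_tau|exact: smooth1_continuous].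
Qed.

Lemma radial_gen_derive f : radial_gen f -> forall v, exists2 g, alg radial_gen g &
  forall x, punctured x -> is_derive x v f (g x).
Proof.
move=> [->|[->|[G sG ->]]] v.
- by exists (fun=> v.1); [exact: alg_cst|move=> x _; exact: is_derive_fst].
- by exists (fun=> v.2); [exact: alg_cst|move=> x _; exact: is_derive_snd].
have [g sg Gg] := smooth1_deriv sG.
exists (fun x => (g \o tau) x * ((x.1 * v.1 + x.2 * v.2) *
    ((fun t => expR (- 2 * t)) \o tau) x)).
  apply: alg_mul; first by apply: alg_gen; right; right; exists g.
  apply: alg_mul.
    apply: alg_add; (apply: alg_mul; last exact: alg_cst); apply: alg_gen; first by left.
    by right; left.
  by apply: alg_gen; right; right; eexists; first exact: (smooth1_exp_lin (- 2)).
move=> x x0; have := is_derive_radial v Gg x0.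
by move=> H; apply: (is_derive_eq H); rewrite /= expRN_tau.
Qed.

Lemma alg_radial_smooth_on U f : open U -> U `<=` punctured -> alg radial_gen f -> smooth_on U f.
Proof.
move=> oU Up; apply: alg_smooth_on => //.
  by move=> g Sg x /Up; exact: radial_gen_continuous.
by move=> g /radial_gen_derive H v; have [h Sh dh] := H v; exists h => // x /Up; exact: dh.
Qed.

Lemma radial_smooth_on G : smooth1 G -> smooth_on punctured (G \o tau).
Proof.
move=> sG; apply: alg_radial_smooth_on => //; first exact: open_punctured.
by apply: alg_gen; right; right; exists G.
Qed.

Lemma grad_sq_radial (G g : R -> R) x : has_deriv G g -> x != 0 ->
  grad_sq (G \o tau) x = g (tau x) ^+ 2 / sqnorm2 x.
Proof.
move=> Gg x0; rewrite /grad_sq.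
have [_ ->] := is_derive_radial (e1 R) Gg x0; have [_ ->] := is_derive_radial (e2 R) Gg x0.
have s0 : sqnorm2 x != 0 by rewrite gt_eqF // sqnorm2_gt0.
rewrite /= !mulr1 !mulr0 addr0 add0r !exprMn -mulrDr -mulrDl -/(sqnorm2 x).
by field.
Qed.

(** In dimension two the logarithmic variable removes the first-order term [u_r / r], leaving
    [g' / r^2]. *)
Lemma laplacian_radial (G g g' : R -> R) x : has_deriv G g -> has_deriv g g' -> x != 0 ->
  laplacian (G \o tau) x = g' (tau x) / sqnorm2 x.
Proof.
move=> Gg gg' x0; rewrite /laplacian.
(* The partial derivatives of [G o tau] are the coordinates times [G2 o tau], so the second
   derivatives follow from the product rule. The two copies of [G2] cancel against the derivative of
   [e^(-2 t)]. *)
pose G2 t := g t * expR (- 2 * t).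
pose g2 t := g' t * expR (- 2 * t) + g t * (- 2 * expR (- 2 * t)).
have dG2 : has_deriv G2 g2.
  apply: has_derivM => //; have := has_deriv_exp_lin (- 2 : R) 0.
  by congr has_deriv; apply/funext => t; rewrite subr0.
have nD : \forall y \near x, y != 0.
  exact: (open_nbhs_nbhs (conj open_punctured x0)).
have s0 : sqnorm2 x != 0 by rewrite gt_eqF // sqnorm2_gt0.
have E1 : 'D_(e1 R) ('D_(e1 R) (G \o tau)) x =
    G2 (tau x) + x.1 * (g2 (tau x) * (x.1 / sqnorm2 x)).
  have H := is_deriveM (is_derive_radial (e1 R) dG2 x0) (is_derive_fst x (e1 R)).
  rewrite (near_eq_derive (g := (G2 \o tau) * fst)).
    have [_ ->] := H; rewrite /GRing.scale /= !mulr1 !mulr0 addr0 //.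
  near=> y.
  have y0 : y != 0 by near: y.
  have [_ ->] := is_derive_radial (e1 R) Gg y0.
  have -> : ((G2 \o tau) * fst) y = G2 (tau y) * y.1 by [].
  by rewrite /= mulr1 mulr0 addr0 /G2 expRN_tau //; ring.
have E2 : 'D_(e2 R) ('D_(e2 R) (G \o tau)) x =
    G2 (tau x) + x.2 * (g2 (tau x) * (x.2 / sqnorm2 x)).
  have H := is_deriveM (is_derive_radial (e2 R) dG2 x0) (is_derive_snd x (e2 R)).
  rewrite (near_eq_derive (g := (G2 \o tau) * snd)).
    have [_ ->] := H; rewrite /GRing.scale /= !mulr1 !mulr0 add0r //.
  near=> y.
  have y0 : y != 0 by near: y.
  have [_ ->] := is_derive_radial (e2 R) Gg y0.
  have -> : ((G2 \o tau) * snd) y = G2 (tau y) * y.2 by [].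
  by rewrite /= mulr1 mulr0 add0r /G2 expRN_tau //; ring.
rewrite E1 E2 /G2 /g2 expRN_tau //.
have sE : x.2 ^+ 2 = sqnorm2 x - x.1 ^+ 2 by rewrite /sqnorm2; ring.
transitivity (2 * (g (tau x) / sqnorm2 x) + (x.1 ^+ 2 + x.2 ^+ 2) / sqnorm2 x *
  (g' (tau x) / sqnorm2 x - 2 * (g (tau x) / sqnorm2 x))); first by ring.
by rewrite -/(sqnorm2 x); field.
Unshelve. all: by end_near.
Qed.

End Radial.

(** * Annuli *)

Section Annulus.
Variable R : realType.

Lemma continuous_pair (T U W : topologicalType) (f : T -> U) (g : T -> W) :
  continuous f -> continuous g -> continuous (fun x => (f x, g x)).
Proof.
move=> cf cg x.
exact: (@cvg_pair _ _ _ _ (nbhs (f x)) (nbhs (g x)) _ _ _ f g (cf x) (cg x)).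
Qed.

Definition annulus (al be : R) : set (R * R) := [set x | al < sqnorm2 x < be].

Lemma open_annulus al be : open (annulus al be).
Proof.
have -> : annulus al be = @sqnorm2 R @^-1` `]al, be[.
  by apply/seteqP; split=> x /=; rewrite /annulus /= in_itv.
by apply: open_comp => [x _|]; [exact: continuous_sqnorm2|exact: interval_open].
Qed.

Lemma closure_annulus al be x : closure (annulus al be) x -> al <= sqnorm2 x <= be.
Proof.
have cl : closed (@sqnorm2 R @^-1` `[al, be]).
  by apply: closed_comp => [y _|]; [exact: continuous_sqnorm2|exact: interval_closed].
move=> Ax; have : (@sqnorm2 R @^-1` `[al, be]) x.
  rewrite ((closure_id _).1 cl); move: Ax; apply: closure_subset => y /=.
  by rewrite /annulus /= in_itv /= => /andP[/ltW -> /ltW ->].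
by rewrite /= in_itv.
Qed.

(** The annulus is a union of half circles, the sign bit choosing the upper or the lower one. Each
    is joined to the same segment of the positive axis, which it meets at [(sqrt s, 0)]. *)
Lemma connected_annulus al be : 0 < al -> al < be -> connected (annulus al be).
Proof.
move=> al0 albe.
have sal0 : 0 < Num.sqrt al by rewrite sqrtr_gt0.
pose ray := (fun r : R => (r, 0 : R)) @` `]Num.sqrt al, Num.sqrt be[.
pose arc (i : R * bool) := (fun x : R => (x, (-1) ^+ i.2 * Num.sqrt (i.1 - x ^+ 2))) @`
  `[- Num.sqrt i.1, Num.sqrt i.1].
pose P := [set i : R * bool | al < i.1 < be].
have rayP r : ray (r, 0) <-> Num.sqrt al < r < Num.sqrt be.
  split=> [[r' /=]|h]; first by rewrite in_itv /= => h [<-].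
  by exists r => //=; rewrite in_itv.
have sq (s r : R) : 0 < s -> 0 <= r -> (Num.sqrt s < r) = (s < r ^+ 2) /\ (r < Num.sqrt s) = (r ^+ 2 < s).
  move=> s0 r0.
  have E1 : s < r ^+ 2 = (Num.sqrt s < r).
    rewrite -[in LHS](sqr_sqrtr (ltW s0)) ltr_sqr ?nnegrE ?sqrtr_ge0 //.
  have E2 : r ^+ 2 < s = (r < Num.sqrt s).
    rewrite -[in LHS](sqr_sqrtr (ltW s0)) ltr_sqr ?nnegrE ?sqrtr_ge0 //.
  by rewrite E1 E2.
have ray_s s : al < s < be -> ray (Num.sqrt s, 0).
  move=> /andP[as_ sb]; have s0 : 0 < s by exact: lt_trans as_.
  by apply/rayP; rewrite !ltr_sqrt ?as_ ?sb // (lt_trans s0).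
have -> : annulus al be = \bigcup_(i in P) (ray `|` arc i).
  apply/seteqP; split=> [x|x].
    rewrite /annulus /= => xs.
    exists (sqnorm2 x, x.2 < 0) => //; right => /=.
    have x1 : `|x.1| <= Num.sqrt (sqnorm2 x).
      by rewrite -(sqrtr_sqr x.1) ler_sqrt ?lerDl ?sqr_ge0 // sqnorm2_ge0.
    exists x.1; first by rewrite /= in_itv /= -ler_norml.
    rewrite [RHS]surjective_pairing; congr pair.
    have -> : sqnorm2 x - x.1 ^+ 2 = x.2 ^+ 2 by rewrite /sqnorm2; ring.
    by rewrite sqrtr_sqr mulr_sign_norm.
  move=> [[s b] /= Ps [rx|[y]]].
    move: rx => [r /=]; rewrite in_itv /= => /andP[h1 h2] <-.
    have r0 : 0 <= r by rewrite ltW // (lt_trans sal0).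
    rewrite /annulus /sqnorm2 /= expr0n /= addr0.
    have be0 : 0 < be by exact: lt_trans albe.
    by have [<- _] := sq _ _ al0 r0; have [_ <-] := sq _ _ be0 r0; rewrite h1.
  rewrite /= in_itv /= -ler_norml => hy <-; move: Ps; rewrite /P /annulus /sqnorm2 /= => Ps.
  have s0 : 0 <= s by case/andP: Ps => as_ _; rewrite ltW // (lt_trans al0).
  have : y ^+ 2 <= s.
    by rewrite -[leLHS]real_normK ?num_real // -(sqr_sqrtr s0) ler_sqr ?nnegrE ?sqrtr_ge0.
  move=> ys; rewrite exprMn sqr_sqrtr ?subr_ge0 // -exprM muln2 -signr_odd odd_double expr0 mul1r.
  by rewrite addrC subrK.
apply: bigcup_connected.
  exists (Num.sqrt ((al + be) / 2), 0) => i _; left; apply: ray_s.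
  by apply/andP; split; lra.
move=> [s b] Ps; apply: connectedU.
- exists (Num.sqrt s, 0); split; first exact: ray_s.
  have s0 : 0 <= s by case/andP: Ps => /= as_ _; rewrite ltW // (lt_trans al0).
  exists (Num.sqrt s); first by rewrite /= in_itv /= lexx andbT; have := sqrtr_ge0 s; lra.
  by rewrite /= sqr_sqrtr // subrr sqrtr0 mulr0.
- apply: connected_continuous_connected.
    by apply/connected_intervalP; exact: interval_is_interval.
  apply: continuous_subspaceT => r.
  by apply: (@continuous_pair _ _ _ id (fun=> 0)) => {}r; [exact: cvg_id|exact: cvg_cst].
- apply: connected_continuous_connected.
    by apply/connected_intervalP; exact: interval_is_interval.
  apply: continuous_subspaceT => r.
  apply: (@continuous_pair _ _ _ id (fun x : R => (-1) ^+ b * Num.sqrt (s - x ^+ 2))) => {}r.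
    exact: cvg_id.
  apply: cvgM; first exact: cvg_cst.
  apply: continuous_comp; last exact: sqrt_continuous.
  apply: cvgB; first exact: cvg_cst.
  exact: exprn_continuous.
Qed.

(** At a boundary point only one of the two constraints is active. In a small ball the other one
    holds automatically, and [al - |x|^2] or [|x|^2 - be] is a defining function, whose squared
    gradient is [4 |x|^2]. *)
Lemma smooth_bounded_annulus al be : 0 < al -> al < be ->
  smooth_bounded_domain (annulus al be).
Proof.
move=> al0 albe; split; first exact: open_annulus.
split; first exact: connected_annulus.
split.
  exists (Num.sqrt ((al + be) / 2), 0).
  by rewrite /annulus /sqnorm2 /= sqr_sqrtr ?expr0n ?addr0; [apply/andP; split|]; lra.
split.
  exists (be + 1); split=> [|M bM x]; first exact: num_real.
  rewrite /annulus /= => /andP[_ xb].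
  have key y : y ^+ 2 <= sqnorm2 x -> `|y| <= M.
    move=> yx; rewrite ler_norml; apply/andP; split; nra.
  rewrite prod_normE /= ge_max; apply/andP; split; apply: key; rewrite /sqnorm2.
    by rewrite lerDl sqr_ge0.
  by rewrite lerDr sqr_ge0.
move=> p [/closure_annulus pab pn].
have gs x : grad_sq (@sqnorm2 R) x = 4 * sqnorm2 x.
  rewrite /grad_sq; have [_ ->] := is_derive_sqnorm2 x (e1 R).
  by have [_ ->] := is_derive_sqnorm2 x (e2 R); rewrite /sqnorm2 /=; ring.
have algs : alg (@radial_gen R) (@sqnorm2 R).
  have -> : @sqnorm2 R = (fun x => x.1 * x.1 + x.2 * x.2).
    by apply/funext => x; rewrite /sqnorm2 !expr2.
  by apply: alg_add; apply: alg_mul; apply: alg_gen; do ?[by left|by right; left].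
have cs : {for p, continuous (@sqnorm2 R)} by exact: continuous_sqnorm2.
have [pa|pa] := eqVneq (sqnorm2 p) al.
- have : \forall x \near p, 0 < sqnorm2 x < be.
    have h1 : 0 < sqnorm2 p by rewrite pa.
    have h2 : sqnorm2 p < be by rewrite pa.
    near=> x; apply/andP; split; near: x.
      exact: (cvgr_gt (sqnorm2 p)).
    exact: (cvgr_lt (sqnorm2 p)).
  move=> /nbhs_ballP[r /= r0 rP]; exists r; split => //.
  exists (fun x => al + - sqnorm2 x).
  have sub : ball p r `<=` @punctured R.
    by move=> x /rP /andP[+ _]; rewrite /punctured /= -sqnorm2_gt0.
  split; first by apply: alg_radial_smooth_on => //; [exact: ball_open|
    apply: alg_add; [exact: alg_cst|exact: alg_opp]].
  split=> x /rP /andP[x0 xb].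
    have -> : grad_sq (fun x => al + - sqnorm2 x) x = grad_sq (@sqnorm2 R) x.
      have dd v : 'D_v (fun x => al + - sqnorm2 x) x = - 'D_v (@sqnorm2 R) x.
        have [h1 h2] := is_derive_sqnorm2 x v.
        have := is_deriveD (is_derive_cst al x v) (is_deriveN (derivableP h1)).
        by move=> [_ ->]; rewrite add0r.
      by rewrite /grad_sq !dd !sqrrN.
    by rewrite gs gt_eqF // mulr_gt0.
  rewrite /annulus /= xb andbT; split; lra.
have pb : sqnorm2 p = be.
  apply/eqP; rewrite eq_le; case/andP: pab => h1 ->; rewrite /= leNgt.
  by apply/negP => h2; apply: pn; rewrite /annulus /= h2 andbT lt_neqAle eq_sym pa.
have : \forall x \near p, al < sqnorm2 x.
  have h : al < sqnorm2 p by rewrite pb.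
  by near=> x; near: x; exact: (cvgr_gt (sqnorm2 p)).
move=> /nbhs_ballP[r /= r0 rP]; exists r; split => //.
exists (fun x => sqnorm2 x + - be).
have sub : ball p r `<=` @punctured R.
  by move=> x /rP h; rewrite /punctured /= -sqnorm2_gt0; exact: lt_trans h.
split; first by apply: alg_radial_smooth_on => //; [exact: ball_open|
  apply: alg_add; [by []|exact: alg_cst]].
split=> x /rP xa.
  have -> : grad_sq (fun x => sqnorm2 x + - be) x = grad_sq (@sqnorm2 R) x.
    have dd v : 'D_v (fun x => sqnorm2 x + - be) x = 'D_v (@sqnorm2 R) x.
      have [h1 h2] := is_derive_sqnorm2 x v.
      have := is_deriveD (derivableP h1) (is_derive_cst (- be) x v).
      by move=> [_ ->]; rewrite addr0.
    by rewrite /grad_sq !dd.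
  by rewrite gs gt_eqF // mulr_gt0 // (lt_trans al0).
rewrite /annulus /= xa /=; split; lra.
Unshelve. all: by end_near.
Qed.

End Annulus.

(** * Polar coordinates *)

Section Area.
Variable R : realType.
Local Notation mu := (@lebesgue_measure R).
Local Notation mu2 := (mu \x mu)%E.
Local Notation R2 := (measurableTypeR R * measurableTypeR R)%type.

Lemma measurable_sqnorm2 : measurable_fun [set: R2] (@sqnorm2 R).
Proof.
by apply: measurable_funD; apply: measurable_funX; [exact: measurable_fst|exact: measurable_snd].
Qed.

Definition shell (al be : R) : set R2 := [set x | al <= sqnorm2 x < be].

Lemma measurable_shell al be : measurable (shell al be).
Proof.
have := @measurable_sqnorm2 measurableT `[al, be[%classic (measurable_itv _).
by rewrite setTI.
Qed.

Definition disk (s : R) : set R2 := [set x | sqnorm2 x < s].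

Lemma measurable_disk s : measurable (disk s).
Proof.
have := @measurable_sqnorm2 measurableT `]-oo, s[%classic (measurable_itv _).
by rewrite setTI.
Qed.

Lemma area_diskE (s : R) : mu2 (disk s) =
  (\int[mu]_x (2 * Num.sqrt (s - x ^+ 2))%:E)%E.
Proof.
apply: eq_integral => x _ /=.
set q := Num.sqrt _.
have q0 : 0 <= q by exact: sqrtr_ge0.
have -> : xsection (disk s) x = `]- q, q[%classic.
  rewrite xsectionE; apply/seteqP; split => y; rewrite /disk /sqnorm2 /= in_itv /= -ltr_norml.
    move=> h; rewrite -sqrtr_sqr /q ltr_sqrt; have := sqr_ge0 y; lra.
  move=> h.
  have : 0 < q by exact: le_lt_trans h.
  rewrite sqrtr_gt0 => h2.
  move: h; rewrite -sqrtr_sqr /q ltr_sqrt //; lra.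
rewrite lebesgue_measure_itv /= lte_fin; case: ltP => h.
  by rewrite -EFinD; congr EFin; ring.
have -> : q = 0 by lra.
by rewrite mulr0.
Qed.

(** Slices of the disk reduce its area to a one-dimensional integral, where scaling is the
    substitution [x = sqrt s * x']. *)
Lemma area_disk_scale (s : R) : 0 < s -> mu2 (disk s) = (s%:E * mu2 (disk 1))%E.
Proof.
move=> s0; rewrite !area_diskE.
have rs0 : 0 < Num.sqrt s by rewrite sqrtr_gt0.
pose F (x : R) := Num.sqrt s * x.
have dF : has_deriv F (fun=> Num.sqrt s).
  by apply: has_deriv_ext (has_derivZ _ (@has_deriv_id R)) _ => t; rewrite mulr1.
have F'E : F^`()%classic = (fun=> Num.sqrt s).
  by apply/funext => x; rewrite derive1E; have [_ ->] := dF x.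
pose G (x : R) := 2 * Num.sqrt (s - x ^+ 2).
have cG (r : R) : continuous (fun x : R => 2 * Num.sqrt (r - x ^+ 2)).
  move=> x; apply: cvgM; first exact: cvg_cst.
  apply: continuous_comp; last exact: sqrt_continuous.
  by apply: cvgB; [exact: cvg_cst|exact: exprn_continuous].
rewrite -[LHS]/(\int[mu]_x (G x)%:E)%E.
rewrite (@increasing_ge0_integration_by_substitutionT R F G); first last.
- by move=> x; rewrite mulr_ge0 // sqrtr_ge0.
- exact: cG.
- rewrite /F; apply: gt0_cvgMry => //.
- rewrite /F; apply: gt0_cvgMrNy => //.
- by move=> x; have [] := dF x.
- by rewrite F'E; apply: is_cvg_cst.
- by rewrite F'E; apply: is_cvg_cst.
- by rewrite F'E => x; apply: cvg_cst.
- by move=> x y xy; rewrite /F ltr_pM2l.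
rewrite -ge0_integralZl //; first last.
- by rewrite lee_fin ltW.
- by apply/measurable_EFinP; apply: continuous_measurable_fun; exact: cG.
apply: eq_integral => x _; rewrite -EFinM; congr EFin.
have -> : ((G \o F) * F^`()%classic) x = G (F x) * F^`()%classic x by [].
rewrite F'E /G /F.
have -> : s - (Num.sqrt s * x) ^+ 2 = s * (1 - x ^+ 2).
  by rewrite exprMn sqr_sqrtr ?ltW //; ring.
rewrite sqrtrM ?ltW // -[in RHS](sqr_sqrtr (ltW s0)).
by ring.
Qed.

End Area.

(** * Integrals of radial functions over annuli *)

Section Polar.
Variable R : realType.
Local Notation mu := (@lebesgue_measure R).
Local Notation mu2 := (mu \x mu)%E.
Local Notation R2 := (measurableTypeR R * measurableTypeR R)%type.

Lemma area_square (q : R) : 0 < q -> mu2 (`]- q, q[ `*` `]- q, q[) = (4 * q ^+ 2)%:E.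
Proof.
move=> q0.
have E : mu `]- q, q[ = (2 * q)%:E.
  have qq : - q < q by lra.
  by rewrite lebesgue_measure_itv /= lte_fin qq -EFinD; congr EFin; ring.
rewrite product_measure1E; [|exact: measurable_itv|exact: measurable_itv].
transitivity ((2 * q)%:E * (2 * q)%:E)%E; first by congr (_ * _)%E; exact: E.
by rewrite -EFinM; congr EFin; ring.
Qed.

(** The value of [k] is irrelevant, as it multiplies every energy alike. An inscribed and a
    circumscribed square show that it is positive and finite. *)
Lemma area_disk : exists2 k : R, 0 < k & forall s, 0 < s -> mu2 (disk s) = (k * s)%:E.
Proof.
have msq q : measurable (`]- q, q[ `*` `]- q, q[ : set R2).
  by apply: measurableX; exact: measurable_itv.
have lo : (1%:E <= mu2 (disk 1))%E.
  have -> : 1%:E = mu2 (`]- 2^-1, 2^-1[ `*` `]- 2^-1, 2^-1[).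
    by rewrite area_square ?invr_gt0 //; congr EFin; field.
  apply: le_measure; rewrite ?inE //; first exact: measurable_disk.
  move=> [x y] [/=]; rewrite !in_itv /= => /andP[? ?] /andP[? ?].
  by rewrite /disk /sqnorm2 /=; nra.
have hi : (mu2 (disk 1) <= 4%:E)%E.
  have -> : 4%:E = mu2 (`]- 1, 1[ `*` `]- 1, 1[).
    by rewrite area_square //; congr EFin; ring.
  apply: le_measure; rewrite ?inE //; first exact: measurable_disk.
  move=> [x y]; rewrite /disk /sqnorm2 /= => h.
  have := sqr_ge0 x; have := sqr_ge0 y => ? ?.
  by split; rewrite /= in_itv /=; apply/andP; split; nra.
have fin : mu2 (disk 1) \is a fin_num.
  rewrite fin_real //; apply/andP; split.
    exact: lt_le_trans (ltNye 0) (le_trans _ lo).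
  exact: le_lt_trans hi (ltry 4).
exists (fine (mu2 (disk 1))).
  by rewrite -lte_fin fineK // (lt_le_trans _ lo) // lte_fin.
by move=> s s0; rewrite area_disk_scale // mulrC EFinM fineK.
Qed.

Variable k : R.
Hypothesis k0 : 0 < k.
Hypothesis areaE : forall s, 0 < s -> mu2 (disk s) = (k * s)%:E.

Lemma disk_shell (al be : R) : al <= be -> disk be = disk al `|` shell al be.
Proof.
move=> ab; apply/seteqP; split => x; rewrite /disk /shell /=.
  by move=> ->; rewrite andbT; case: (ltP (sqnorm2 x) al) => h; [left|right].
by case=> [h|/andP[]//]; exact: lt_le_trans ab.
Qed.

Lemma disjoint_disk_shell (al be : R) : disk al `&` shell al be = set0.
Proof.
by apply/seteqP; split => x // [] /=; rewrite /disk /shell /= => h /andP[]; rewrite leNgt h.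
Qed.

Lemma area_shell (al be : R) : 0 < al -> al <= be -> mu2 (shell al be) = (k * (be - al))%:E.
Proof.
move=> al0 ab.
have be0 : 0 < be by exact: lt_le_trans ab.
have h : (mu2 (disk al) + mu2 (shell al be) = (k * be)%:E)%E.
  rewrite -areaE // (disk_shell ab); apply/esym/measureU.
  - exact: measurable_disk.
  - exact: measurable_shell.
  - exact: disjoint_disk_shell.
rewrite areaE // in h.
have : (mu2 (shell al be) = (k * be)%:E - (k * al)%:E)%E by rewrite -h addeAC subee // add0e.
by rewrite -EFinB mulrBr.
Qed.

Lemma area_circle (al : R) : 0 < al -> mu2 (shell al al `|` [set x | sqnorm2 x = al]) = 0%E.
Proof.
move=> al0.
have mc : measurable (shell al al `|` [set x | sqnorm2 x = al] : set R2).
  apply: measurableU; first exact: measurable_shell.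
  have := @measurable_sqnorm2 R measurableT [set al] (measurable_set1 _).
  by rewrite setTI.
have H d : 0 < d -> (mu2 (shell al al `|` [set x | sqnorm2 x = al]) <= (k * d)%:E)%E.
  move=> d0; have -> : d = (al + d) - al by ring.
  rewrite -area_shell //; last by lra.
  apply: le_measure; rewrite ?inE //; first exact: measurable_shell.
  by move=> x; rewrite /shell /= => -[/andP[h h1]|->]; apply/andP; split; lra.
apply/eqP; rewrite eq_le measure_ge0 andbT; apply/lee_addgt0Pr => e e0.
have := H (e / k); rewrite add0e => /(_ (divr_gt0 e0 k0)).
by rewrite mulrC divfK // gt_eqF.
Qed.

Lemma measurable_tau : measurable_fun [set: R2] (@tau R).
Proof.
apply: measurable_funM; last exact: measurable_cst.
by apply: (measurableT_comp (@measurable_ln R)); exact: measurable_sqnorm2.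
Qed.

(** Differentiation of [F] with respect to another function [U] instead of [t]: with [U] the area of
    a disk it gives polar coordinates, with [U] the identity it is the usual test for a
    derivative. *)
Lemma is_derive_ratio (F U : R -> R) (t c u : R) :
  (forall z, U z = U t -> z = t) ->
  (forall e, 0 < e -> \forall z \near t, `|F z - F t - c * (U z - U t)| <= e * `|U z - U t|) ->
  is_derive t (1 : R) U u -> is_derive t (1 : R) F (c * u).
Proof.
move=> Uinj H /is_derive1_caratheodory[m [mE cm mt]].
apply/is_derive1_caratheodory.
pose r z := if z == t then c else (F z - F t) / (U z - U t).
exists (fun z => r z * m z); split.
- move=> z; rewrite /r -mulrA -mE; case: eqVneq => [->|zt].
    by rewrite !subrr mulr0.
  by rewrite divfK // subr_eq0; apply/eqP => /Uinj; apply/eqP.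
- apply: cvgM => //; apply/cvgrPdist_le => e e0.
  near=> z; rewrite /r eqxx; case: eqVneq => [_|zt]; first by rewrite subrr normr0 ltW.
  have U0 : U z - U t != 0 by rewrite subr_eq0; apply/eqP => /Uinj; apply/eqP.
  have -> : c - (F z - F t) / (U z - U t) = - ((F z - F t - c * (U z - U t)) / (U z - U t)).
    by field.
  rewrite normrN normrM normfV ler_pdivrMr ?normr_gt0 //.
  by near: z; exact: H.
- by rewrite /r eqxx mt.
Unshelve. all: by end_near.
Qed.

Lemma dist_mul_le (x c e m : R) : x <= (c + e) * m -> (c - e) * m <= x ->
  `|x - c * m| <= e * m.
Proof. by move=> h1 h2; rewrite ler_norml; apply/andP; split; lra. Qed.

Lemma subrrBM (x y c u v : R) : x - y - c * (u - v) = - (y - x - c * (v - u)).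
Proof. by ring. Qed.

Section PolarIntegral.
Variables (h : R -> R) (M : R).
Hypothesis ch : continuous h.
Hypothesis hM : forall t, `|h t| <= M.

Let f : R2 -> R := h \o @tau R.

Lemma integrable_radial (B : set R2) (s : R) : measurable B -> B `<=` disk s -> 0 < s ->
  mu2.-integrable B (EFin \o f).
Proof.
move=> mB Bs s0; apply: (@integrableS _ _ _ _ (disk s)) => //; first exact: measurable_disk.
apply: measurable_bounded_integrable.
- exact: measurable_disk.
- apply: le_lt_trans (ltry (k * s)).
  by rewrite -areaE.
- apply: measurable_funTS; apply: measurableT_comp; last exact: measurable_tau.
  exact: continuous_measurable_fun.
- exists M; split; first exact: num_real.
  by move=> N MN x _; apply: le_trans (hM _) (ltW MN).
Qed.

Let Phi (t : R) : R := (\int[mu2]_(x in disk (expR (2 * t))) f x)%R.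

Lemma shell_tau (t z : R) (x : R2) : shell (expR (2 * t)) (expR (2 * z)) x -> t <= tau x <= z.
Proof.
rewrite /shell /= => /andP[h1 h2].
have s0 : 0 < sqnorm2 x by exact: lt_le_trans (expR_gt0 _) h1.
have E : sqnorm2 x = expR (2 * tau x) by rewrite expR_tau // -sqnorm2_gt0.
by move: h1 h2; rewrite E ler_expR ltr_expR => ? ?; apply/andP; split; lra.
Qed.

Lemma Phi_diff (t z : R) : t <= z ->
  Phi z - Phi t = (\int[mu2]_(x in shell (expR (2 * t)) (expR (2 * z))) f x)%R.
Proof.
move=> tz; rewrite /Phi.
have e : expR (2 * t) <= expR (2 * z) by rewrite ler_expR; lra.
rewrite (disk_shell e) Rintegral_setU.
- by ring.
- exact: measurable_disk.
- exact: measurable_shell.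
- apply: (@integrable_radial _ (expR (2 * z))); last exact: expR_gt0.
    by apply: measurableU; [exact: measurable_disk|exact: measurable_shell].
  by rewrite -disk_shell.
- by apply/disj_setPS; rewrite disjoint_disk_shell.
Qed.

Lemma Phi_bound (t z c e : R) : t <= z -> (forall r, t <= r <= z -> `|h r - c| <= e) ->
  `|Phi z - Phi t - c * (k * expR (2 * z) - k * expR (2 * t))| <=
    e * (k * expR (2 * z) - k * expR (2 * t)).
Proof.
move=> tz H; rewrite Phi_diff //.
have ee : expR (2 * t) <= expR (2 * z) by rewrite ler_expR; lra.
set B := shell _ _.
have mB : measurable B by exact: measurable_shell.
have muB : mu2 B = (k * expR (2 * z) - k * expR (2 * t))%:E.
  by rewrite area_shell ?expR_gt0 // mulrBr.
have iB : mu2.-integrable B (EFin \o f).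
  apply: (@integrable_radial _ (expR (2 * z))) => //; last exact: expR_gt0.
  by move=> x; rewrite /B /shell /disk /= => /andP[].
have iC (r : R) : mu2.-integrable B (EFin \o (fun=> r)).
  apply: measurable_bounded_integrable => //.
    by apply: le_lt_trans (ltry (k * expR (2 * z) - k * expR (2 * t))); rewrite -muB.
  by exists `|r|; split => // N rN x _; exact: ltW.
have IC r : (\int[mu2]_(x in B) r)%R = r * (k * expR (2 * z) - k * expR (2 * t)).
  rewrite Rintegral_cst //; congr (_ * _).
  by rewrite -[RHS]/(fine (k * expR (2 * z) - k * expR (2 * t))%:E) -muB.
have fb x : B x -> c - e <= f x <= c + e.
  move=> /shell_tau /H; rewrite /f /= ler_norml => /andP[? ?].
  by apply/andP; split; lra.
have h1 : (\int[mu2]_(x in B) f x)%R <= (\int[mu2]_(x in B) (c + e))%R.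
  by apply: le_Rintegral => // x /fb /andP[].
have h2 : (\int[mu2]_(x in B) (c - e))%R <= (\int[mu2]_(x in B) f x)%R.
  by apply: le_Rintegral => // x /fb /andP[].
by rewrite !IC in h1 h2; exact: dist_mul_le.
Qed.

(** On a thin shell [h o tau] is nearly constant, so [Phi] grows like [h] times the area, and the
    area has an explicit derivative. *)
Lemma has_deriv_Phi : has_deriv Phi (fun t => h t * (k * (2 * expR (2 * t)))).
Proof.
move=> t.
pose U (t : R) := k * expR (2 * t).
have dU : has_deriv U (fun t => k * (2 * expR (2 * t))).
  by apply: has_derivZ; exact: has_deriv_exp2.
apply: (@is_derive_ratio Phi U) (dU t).
  move=> z /(mulfI (lt0r_neq0 k0)) /expR_inj; lra.
move=> e e0; have : \forall r \near t, `|h t - h r| <= e.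
  have cht : {for t, continuous h} by exact: ch.
  by move: cht => /cvgrPdist_le; apply.
move=> /nbhs_ballP[d /= d0 dP].
have : \forall z \near t, ball t d z by exact: nbhsx_ballx.
apply: filterS => z; rewrite /ball /= => tz.
have [le|/ltW ge] := leP t z.
  rewrite (ger0_norm (_ : 0 <= U z - U t)).
    apply: Phi_bound => // r /andP[tr rz]; rewrite distrC; apply: dP.
    rewrite /ball /= distrC ger0_norm ?subr_ge0 //.
    by move: tz; rewrite distrC ger0_norm ?subr_ge0 //; lra.
  by rewrite subr_ge0 /U ler_pM2l // ler_expR; lra.
rewrite subrrBM.
rewrite normrN (distrC (U z)) (ger0_norm (_ : 0 <= U t - U z)).
  apply: Phi_bound => // r /andP[zr rt]; rewrite distrC; apply: dP.
  rewrite /ball /= ger0_norm ?subr_ge0 //.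
  by move: tz; rewrite ger0_norm ?subr_ge0 //; lra.
by rewrite subr_ge0 /U ler_pM2l // ler_expR; lra.
Qed.

Lemma integral_shell (a b : R) : a < b ->
  (\int[mu2]_(x in annulus (expR (2 * a)) (expR (2 * b))) (f x)%:E)%E = (Phi b - Phi a)%:E.
Proof.
move=> ab; rewrite Phi_diff ?ltW //.
set al := expR _; set be := expR _.
have al0 : 0 < al by exact: expR_gt0.
have be0 : 0 < be by exact: expR_gt0.
pose N : set R2 := shell al al `|` [set x | sqnorm2 x = al].
have mS : measurable (shell al be) by exact: measurable_shell.
have mN : measurable N.
  apply: measurableU; first exact: measurable_shell.
  have := @measurable_sqnorm2 R measurableT [set al] (measurable_set1 _).
  by rewrite setTI.
have iS : mu2.-integrable (shell al be) (EFin \o f).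
  apply: (@integrable_radial _ be) => //.
  by move=> x; rewrite /shell /disk /= => /andP[].
have -> : annulus al be = shell al be `\` N.
  apply/seteqP; split => x; rewrite /annulus /shell /N /=.
    move=> /andP[h1 h2]; rewrite (ltW h1) h2; split => //.
    by case=> [/andP[_]|h3]; [rewrite ltNge ltW|rewrite h3 ltxx in h1].
  case=> /andP[h1 h2] h3; rewrite h2 andbT lt_neqAle h1 andbT.
  by apply/eqP => h4; apply: h3; right.
rewrite -negligible_integral //; last exact: area_circle.
by rewrite /Rintegral fineK //; exact: integrable_fin_num.
Qed.

End PolarIntegral.

Lemma polar_integral (h H : R -> R) (a b : R) : continuous h ->
  has_deriv H (fun t => h t * expR (2 * t)) -> a < b ->
  (\int[mu2]_(x in annulus (expR (2 * a)) (expR (2 * b))) (h (tau x))%:E)%E =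
    (2 * k * (H b - H a))%:E.
Proof.
move=> ch dH ab.
(* [h] may be unbounded as [t -> -oo], that is, near the origin. Freezing it outside [[a, b]] makes
   it bounded, hence integrable over disks, without changing it on the annulus. *)
pose cl (t : R) := Num.min (Num.max t a) b.
have ccl : continuous cl.
  move=> t; apply: (@continuous_min R R (id \max cst a) (cst b)).
    by apply: (@continuous_max R R id (cst a)); [exact: cvg_id|exact: cvg_cst].
  exact: cvg_cst.
pose g := h \o cl.
have cg : continuous g by move=> t; apply: continuous_comp; [exact: ccl|exact: ch].
have clab t : a <= cl t <= b.
  by rewrite /cl le_min le_max lexx orbT ge_min lexx orbT (ltW ab).
have clE t : a <= t <= b -> cl t = t.
  by move=> /andP[h1 h2]; rewrite /cl (max_idPl _) // (min_idPl _).
have [M gM] : exists M, forall t, `|g t| <= M.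
  have cN : {within `[a, b], continuous (fun t => `|h t|)}.
    by apply: continuous_subspaceT => t; apply: continuous_comp; [exact: ch|exact: norm_continuous].
  have [c _ cM] := EVT_max (ltW ab) cN.
  by exists `|h c| => t; apply: cM; rewrite in_itv; exact: clab.
transitivity (\int[mu2]_(x in annulus (expR (2 * a)) (expR (2 * b))) ((g \o @tau R) x)%:E)%E.
  apply: eq_integral => x; rewrite inE => xA; congr EFin; rewrite /g /= clE //.
  have : shell (expR (2 * a)) (expR (2 * b)) x.
    by move: xA; rewrite /shell /annulus /= => /andP[/ltW -> ->].
  exact: shell_tau.
rewrite (integral_shell cg gM ab); congr EFin.
have dP := has_deriv_Phi cg gM.
have dH2 := has_derivZ (2 * k) dH.
rewrite mulrBr; apply/eqP; rewrite eq_le; apply/andP; split.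
  by apply: (has_deriv_le dP dH2 (ltW ab)) => t tab; rewrite /g /= clE //; lra.
by apply: (has_deriv_le dH2 dP (ltW ab)) => t tab; rewrite /g /= clE //; lra.
Qed.

End Polar.

(** * The potential in the radial variable *)

Section Potential.
Variable R : realType.
Variable V : R * (R * R) -> R.
Hypothesis sV : smooth_on setT V.
Hypothesis cV : compact (closure [set p | V p != 0]).

Definition er : R * (R * R) := (0, (1, 0)).

(** By radial symmetry the ray [(r, 0)] carries all the information. The list keeps derivatives of
    every order in one family; its head is the derivative taken last. *)
Definition vrad (vs : seq (R * (R * R))) (s r : R) : R := iderive vs V (s, (r, 0)).

Lemma vrad_deriv_s vs r : has_deriv (vrad vs ^~ r) (vrad (eu R :: vs) ^~ r).
Proof.
move=> s.
have E (h : R) : h *: eu R + (0, (r, 0)) = (h, (r, 0)).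
  by congr (_, (_, _)) => /=; rewrite /GRing.scale /= ?mulr1 ?mulr0 ?addr0 ?add0r.
have := @derivable_line R _ (iderive vs V) (0, (r, 0)) (eu R) s.
rewrite E; under [X in is_derive _ _ X _]eq_fun do rewrite E.
by apply; exact: (sV vs _).1.
Qed.

Lemma vrad_deriv_r vs s : has_deriv (vrad vs s) (vrad (er :: vs) s).
Proof.
move=> r.
have E (h : R) : h *: er + (s, (0, 0)) = (s, (h, 0)).
  by congr (_, (_, _)) => /=; rewrite /GRing.scale /= ?mulr1 ?mulr0 ?addr0 ?add0r.
have := @derivable_line R _ (iderive vs V) (s, (0, 0)) er r.
rewrite E; under [X in is_derive _ _ X _]eq_fun do rewrite E.
by apply; exact: (sV vs _).1.
Qed.

Lemma iderive_supp vs p : ~ closure [set p | V p != 0] p -> iderive vs V p = 0.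
Proof.
set K := closure _.
have oK : open (~` K) by apply: closed_openC; exact: closed_closure.
elim: vs p => [|v vs IH] p Kp /=.
  by apply/eqP/negPn/negP => h; apply: Kp; exact: subset_closure.
rewrite (near_eq_derive (g := cst 0)) ?derive_cst //.
by near=> q; apply: IH; near: q; exact: open_nbhs_nbhs.
Unshelve. all: by end_near.
Qed.

Lemma vrad_supp : exists2 A : R, 1 <= A & forall vs s r,
  A <= `|s| \/ A <= `|r| -> vrad vs s r = 0.
Proof.
have [M [_ HM]] := compact_bounded cV.
pose A := `|M| + 2.
have MA : M < `|M| + 1 by have := ler_norm M; lra.
exists A; first by rewrite /A; have := normr_ge0 M; lra.
move=> vs s r h; apply: iderive_supp => /(HM _ MA) /=.
rewrite !prod_normE /= !ge_max => /andP[h1 /andP[h2 _]].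
by move: h; rewrite /A => -[]; lra.
Qed.

Lemma vrad_bounded vs : exists2 B : R, 0 <= B & forall s r, `|vrad vs s r| <= B.
Proof.
set K := closure [set p | V p != 0].
have [[p0 Kp0]|nK] := pselect (exists p, K p); last first.
  exists 0 => // s r; rewrite /vrad iderive_supp ?normr0 // => h.
  by apply: nK; eexists; exact: h.
have cf : {within K, continuous (fun p => `|iderive vs V p|)}.
  apply: continuous_subspaceT => p; apply: continuous_comp; first exact: (sV vs _).2.
  exact: norm_continuous.
have [c _ cM] := compact_EVT_max (ex_intro _ p0 Kp0) cV cf.
exists `|iderive vs V c| => // s r.
have [h|h] := pselect (K (s, (r, 0))); first by apply: cM; rewrite inE.
by rewrite /vrad iderive_supp ?normr0.
Qed.

Lemma vrad_continuous vs (y q : R -> R) : continuous y -> continuous q ->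
  continuous (fun t => vrad vs (y t) (q t)).
Proof.
move=> cy cq t.
apply: (@continuous_comp _ _ _ (fun t => (y t, (q t, 0 : R))) (iderive vs V)).
  apply: continuous_pair => //; apply: continuous_pair => // u.
  exact: cvg_cst.
exact: (sV vs _).2.
Qed.

(** The bound is a first-order increment times a quantity tending to 0, so it is [o(z - t)]. *)
Lemma is_derive_remainder (rho y q : R -> R) (t C dy dq : R) : 0 <= C ->
  is_derive t (1 : R) y dy -> is_derive t (1 : R) q dq ->
  (forall z, `|rho z| <= C * (`|y z - y t| * (`|y z - y t| + `|q z - q t|))) ->
  is_derive t (1 : R) rho 0.
Proof.
move=> C0 dyt dqt H.
have rt : rho t = 0.
  by apply/eqP; have := H t; rewrite !subrr !normr0 mul0r mulr0 normr_le0.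
have := @is_derive_ratio R rho id t 0 1; rewrite mul0r; apply => //.
have cc (f : R -> R) df : is_derive t (1 : R) f df -> {for t, continuous f}.
  move=> [d _]; apply: differentiable_continuous; exact/derivable1_diffP.
move: (dyt) => /is_derive1_caratheodory[m [mE cm _]] e e0.
pose N := `|m t| + 1.
have N0 : 0 < N by rewrite /N; have := normr_ge0 (m t); lra.
pose d := e / (C * N + 1).
have CN : 0 < C * N + 1 by rewrite ltr_wpDl // mulr_ge0 // ltW.
have d0 : 0 < d by rewrite divr_gt0.
have := cc _ _ dyt; move=> /cvgrPdist_le /(_ (d / 2) (divr_gt0 d0 (ltr0Sn _ 1))) ny.
have := cc _ _ dqt; move=> /cvgrPdist_le /(_ (d / 2) (divr_gt0 d0 (ltr0Sn _ 1))) nq.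
move: cm => /cvgrPdist_le /(_ 1 ltr01) nm.
near=> z.
have h1 : `|y t - y z| <= d / 2 by near: z.
have h2 : `|q t - q z| <= d / 2 by near: z.
have h3 : `|m t - m z| <= 1 by near: z.
rewrite mul0r subr0 rt subr0.
apply: le_trans (H z) _; rewrite mE normrM.
have mN : `|m z| <= N.
  have -> : m z = m t - (m t - m z) by ring.
  by apply: le_trans (ler_normB _ _) _; rewrite /N lerD2l.
have yq : `|m z| * `|z - t| + `|q z - q t| <= d.
  by rewrite -normrM -mE distrC (distrC (q z)); lra.
set a := `|z - t|.
have a0 : 0 <= a by exact: normr_ge0.
apply: le_trans (_ : C * (N * a * d) <= _).
  rewrite ler_wpM2l // ler_pM // ?mulr_ge0 ?addr_ge0 ?mulr_ge0 //.
  by rewrite ler_wpM2r.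
have -> : C * (N * a * d) = (C * N * d) * a by ring.
rewrite ler_wpM2r // /d mulrA ler_pdivrMr // mulrC ler_pM2l //; lra.
Unshelve. all: by end_near.
Qed.

Lemma vrad_taylor vs : exists2 C : R, 0 <= C & forall s s' r,
  `|vrad vs s' r - vrad vs s r - vrad (eu R :: vs) s r * (s' - s)| <= C * `|s' - s| ^+ 2.
Proof.
have [C C0 HC] := vrad_bounded (eu R :: eu R :: vs).
exists C => // s s' r.
exact: (has_deriv_taylor1 s s' (vrad_deriv_s vs r) (vrad_deriv_s (eu R :: vs) r)
  (fun u => HC u r)).
Qed.

(** Only directional derivatives of [V] are given, so the chain rule is rebuilt. The [r] direction
    is followed with [s] frozen at [y t], the [s] direction is linearised, and the bounds on second
    derivatives make the remainder quadratic. *)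
Lemma vrad_chain vs (y z q p : R -> R) : has_deriv y z -> has_deriv q p ->
  has_deriv (fun t => vrad vs (y t) (q t))
    (fun t => vrad (eu R :: vs) (y t) (q t) * z t + vrad (er :: vs) (y t) (q t) * p t).
Proof.
move=> yz qp t.
have [C C0 HC] := vrad_taylor vs.
have [C' C'0 HC'] := vrad_bounded (er :: eu R :: vs).
pose v1 := vrad (eu R :: vs) (y t) (q t).
pose G (x : R) : R := v1 * y x + vrad vs (y t) (q x).
have dG : is_derive t (1 : R) G (v1 * z t + vrad (er :: vs) (y t) (q t) * p t).
  exact: (has_derivD (has_derivZ v1 yz) (has_deriv_comp (vrad_deriv_r vs (y t)) qp) t).
pose rho (x : R) : R := vrad vs (y x) (q x) - v1 * (y x - y t) - vrad vs (y t) (q x).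
have drho : is_derive t (1 : R) rho 0.
  apply: (@is_derive_remainder rho y q t (C + C') (z t) (p t)) => //; first exact: addr_ge0.
  move=> x.
  have -> : rho x = (vrad vs (y x) (q x) - vrad vs (y t) (q x)
      - vrad (eu R :: vs) (y t) (q x) * (y x - y t))
      + (vrad (eu R :: vs) (y t) (q x) - v1) * (y x - y t) by rewrite /rho; ring.
  apply: le_trans (ler_normD _ _) _.
  have h1 := HC (y t) (y x) (q x).
  have h2 : `|vrad (eu R :: vs) (y t) (q x) - v1| <= C' * `|q x - q t|.
    exact: (@has_deriv_lip R _ _ C' (q t) (q x) (vrad_deriv_r (eu R :: vs) (y t)) (HC' (y t))).
  rewrite normrM.
  have := normr_ge0 (y x - y t); have := normr_ge0 (q x - q t); move: h1 h2.
  move: `|_ - v1| `|y x - y t| `|q x - q t| => a b c h1 h2 c0 b0.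
  apply: le_trans (lerD h1 (ler_wpM2r b0 h2)) _.
  have : 0 <= C' * b ^+ 2 + C * (b * c) by rewrite addr_ge0 // !mulr_ge0 // sqr_ge0.
  by lra.
have := is_deriveD dG (is_deriveD drho (is_derive_cst (- (v1 * y t)) t (1 : R))).
rewrite !addr0.
have -> // : G + (rho + cst (- (v1 * y t))) = (fun t => vrad vs (y t) (q t)).
apply/funext => x.
have -> : (G + (rho + cst (- (v1 * y t)))) x = G x + (rho x + - (v1 * y t)) by [].
by rewrite /G /rho; ring.
Qed.

End Potential.

(** * Reduction to the one-dimensional action *)

Section Reduction.
Variable R : realType.
Variable V : R * (R * R) -> R.
Hypothesis sV : smooth_on setT V.
Hypothesis cV : compact (closure [set p | V p != 0]).
Hypothesis rV : forall (s : R) (x y : R * R), sqnorm2 x = sqnorm2 y -> V (s, x) = V (s, y).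

Local Notation vr := (vrad V).
Local Notation es := (eu R).

(** Differentiating along the curve leads from one derivative of [V] to higher ones times [z] and
    [e^t]; with all orders included the family closes up as soon as [z'] lies in the algebra. *)
Definition curve_gen (y z : R -> R) : set (R -> R) :=
  [set f | f = y \/ f = z \/ f = @expR R \/ exists vs, f = fun t => vr vs (y t) (expR t)].

Lemma curve_gen_diff_closed y z Z : has_deriv y z -> has_deriv z Z ->
  alg (curve_gen y z) Z -> diff_closed (curve_gen y z).
Proof.
move=> yz zZ aZ f [->|[->|[->|[vs ->]]]].
- by exists z => //; apply: alg_gen; right; left.
- by exists Z.
- by exists (@expR R); [apply: alg_gen; right; right; left|exact: has_deriv_expR].
eexists; last exact: (vrad_chain sV cV vs yz (@has_deriv_expR R)).
by apply: alg_add; apply: alg_mul; apply: alg_gen; do ?[by left|by right; left|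
  by right; right; left|by right; right; right; eexists].
Qed.

Definition force (y : R -> R) (t : R) : R :=
  - (expR (2 * t) * vr [:: es] (y t) (expR t)).

Lemma solution_smooth1 y z : has_deriv y z -> has_deriv z (force y) -> smooth1 y.
Proof.
move=> yz zf; exists (curve_gen y z); last by apply: alg_gen; left.
apply: curve_gen_diff_closed yz zf _; rewrite /force.
have -> : (fun t => - (expR (2 * t) * vr [:: es] (y t) (expR t))) =
  (fun t => - (expR t * expR t * vr [:: es] (y t) (expR t))).
  by apply/funext => t; rewrite -expRD -mulr2n mulr_natl.
apply: alg_opp; apply: alg_mul; first by apply: alg_mul; apply: alg_gen; right; right; left.
by apply: alg_gen; right; right; right; eexists.
Qed.

Lemma vrad_smooth1 vs c : smooth1 (fun t => vr vs c (expR t)).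
Proof.
exists (curve_gen (fun=> c) (fun=> 0)); last by apply: alg_gen; right; right; right; exists vs.
apply: (@curve_gen_diff_closed _ _ (fun=> 0)); [exact: has_deriv_cst..|exact: alg_cst].
Qed.

Lemma V_radial s x : x != 0 -> V (s, x) = vr [::] s (expR (tau x)).
Proof.
move=> x0; apply: rV; rewrite -expR_tau // /sqnorm2 /= expr0n /= addr0.
by rewrite -expRM_natl mulrC.
Qed.

Lemma dV_radial s x : x != 0 -> 'D_es V (s, x) = vr [:: es] s (expR (tau x)).
Proof.
move=> x0; rewrite /vrad /= /derive.
have E (h : R) (y : R * R) : h *: es + (s, y) = (h + s, y).
  congr pair; first by rewrite /= /GRing.scale /= mulr1.
  by case: y => y1 y2; congr pair => /=; rewrite /GRing.scale /= mulr0 add0r.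
have F : (fun h : R => h^-1 *: ((V \o shift (s, x)) (h *: es) - V (s, x))) =
    (fun h : R => h^-1 *: ((V \o shift (s, (expR (tau x), 0))) (h *: es) -
       V (s, (expR (tau x), 0)))).
  apply/funext => h /=; rewrite !E; congr (_ *: (_ - _)); exact: V_radial.
by rewrite F.
Qed.

Definition solution_data (u : R * R -> R) :=
  [/\ smooth_on (@punctured R) u,
     (forall x y, punctured x -> punctured y -> sqnorm2 x = sqnorm2 y -> u x = u y) &
     (forall x, punctured x -> laplacian u x = - 'D_es V (u x, x))].

Lemma ode_solution_data y z : has_deriv y z -> has_deriv z (force y) ->
  solution_data (y \o @tau R).
Proof.
move=> yz zf; split.
- by apply: radial_smooth_on; exact: solution_smooth1 yz zf.
- by move=> x x' _ _ E; rewrite /= /tau E.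
move=> x x0; rewrite (laplacian_radial yz zf) // dV_radial // /force expR_tau //=.
by field; rewrite gt_eqF // sqnorm2_gt0.
Qed.

Definition lagr (G g : R -> R) (t : R) : R :=
  2^-1 * g t ^+ 2 - expR (2 * t) * vr [::] (G t) (expR t).

Lemma lagr_continuous G g : continuous G -> continuous g -> continuous (lagr G g).
Proof.
move=> cG cg t; apply: cvgB.
  apply: cvgM; first exact: cvg_cst.
  by apply: cvgM; exact: cg.
apply: cvgM; first exact: (has_deriv_continuous (@has_deriv_exp2 R)).
by apply: vrad_continuous => //; exact: continuous_expR.
Qed.

(** The factor [r^-2] in the squared gradient cancels the area element, proportional to
    [e^(2 t) dt], so the kinetic term becomes weightless and the weight falls on the potential
    alone. *)
Lemma energy_radial : exists2 k : R, 0 < k & forall G g N a b,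
  has_deriv G g -> continuous g -> has_deriv N (lagr G g) -> a < b ->
  energy V (annulus (expR (2 * a)) (expR (2 * b))) (G \o @tau R) =
    (k * (N b - N a))%:E.
Proof.
have [k k0 kE] := area_disk R.
exists (2 * k); first by rewrite mulr_gt0.
move=> G g N a b Gg cg dN ab.
pose h t := 2^-1 * g t ^+ 2 * expR (- (2 * t)) - vr [::] (G t) (expR t).
have ch : continuous h.
  move=> t; apply: cvgB.
    apply: cvgM; first by apply: cvgM; [exact: cvg_cst|apply: cvgM; exact: cg].
    apply: continuous_comp; last exact: continuous_expR.
    by apply: cvgN; apply: cvgM; [exact: cvg_cst|exact: cvg_id].
  apply: vrad_continuous => //; last exact: continuous_expR.
  exact: has_deriv_continuous Gg.
have dN' : has_deriv N (fun t => h t * expR (2 * t)).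
  apply: has_deriv_ext dN _ => t; rewrite /lagr /h expRN mulrBl divfK; first by rewrite [X in _ - X]mulrC.
  by rewrite gt_eqF // expR_gt0.
rewrite -(polar_integral k0 kE ch dN' ab) /energy /leb2.
apply: eq_integral => x; rewrite inE /annulus /= => /andP[h1 _].
have x0 : x != 0 by rewrite -sqnorm2_gt0; exact: lt_trans (expR_gt0 _) h1.
rewrite (grad_sq_radial Gg x0) V_radial //= /h expRN expR_tau //.
by rewrite mulrA.
Qed.

Definition all_minimal := forall u, solution_data u -> minimal V (@punctured R) u.

Hypothesis HM : all_minimal.

(** A radial competitor is compared on one annulus, whose boundary circles are [t = a] and [t = b].
    It is smooth on the whole punctured plane, so nothing but the two end values has to match. *)
Lemma action_minimal y z G g NY NG a b :
  has_deriv y z -> has_deriv z (force y) ->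
  smooth1 G -> has_deriv G g -> continuous g -> a < b -> G a = y a -> G b = y b ->
  has_deriv NY (lagr y z) -> has_deriv NG (lagr G g) ->
  NY b - NY a <= NG b - NG a.
Proof.
move=> yz zf sG Gg cg ab Ga Gb dNY dNG.
have [k k0 kE] := energy_radial.
have cz : continuous z := has_deriv_continuous zf.
have ab2 : expR (2 * a) < expR (2 * b) by rewrite ltr_expR; lra.
have cl0 : closure (annulus (expR (2 * a)) (expR (2 * b))) `<=` @punctured R.
  move=> x /closure_annulus /andP[h _]; rewrite /punctured /= -sqnorm2_gt0.
  exact: lt_le_trans (expR_gt0 _) h.
have := HM (ode_solution_data yz zf) (smooth_bounded_annulus (expR_gt0 _) ab2) cl0
  (@open_punctured R) cl0 (radial_smooth_on sG).
rewrite (kE _ _ _ _ _ yz cz dNY ab) (kE _ _ _ _ _ Gg cg dNG ab) lee_fin ler_pM2l //.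
apply=> x [clx nx].
have x0 : x != 0 by exact: cl0.
move: (closure_annulus clx) nx; rewrite /annulus /= -expR_tau // !ler_expR !ltr_expR.
move=> /andP[h1 h2] h3.
have [e|e] : tau x = a \/ tau x = b.
  have [h|h] := eqVneq (tau x) a; first by left.
  right; apply/eqP; rewrite eq_le; apply/andP; split; first by lra.
  rewrite leNgt; apply/negP => h4; apply: h3; apply/andP; split; last by lra.
  by rewrite ltr_pM2l // lt_neqAle eq_sym h /=; lra.
  by rewrite /= e Ga.
by rewrite /= e Gb.
Qed.

End Reduction.

(** * Comparison arguments *)

Section Tools.
Variable R : realType.

Lemma le_add_inv (x y C L0 : R) : (forall L, L0 <= L -> x <= y + C / L) -> x <= y.
Proof.
move=> H; rewrite leNgt; apply/negP => yx.
have d0 : 0 < x - y by rewrite subr_gt0.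
pose L := Num.max L0 ((`|C| + 1) / (x - y)).
have L1 : (`|C| + 1) / (x - y) <= L by rewrite /L le_max lexx orbT.
have Lp : 0 < L by apply: lt_le_trans L1; rewrite divr_gt0 // ltr_wpDl.
have := H L; rewrite {1}/L le_max lexx => /(_ isT).
move: L1; rewrite ler_pdivrMr // => L1.
have : C / L < x - y.
  rewrite ltr_pdivrMr //; have := ler_norm C; lra.
by lra.
Qed.

(** A nonnegative derivative whose antiderivative does not grow forces that antiderivative to be
    constant; continuity of [f] is not assumed. *)
Lemma has_deriv_eq0 (F f : R -> R) (a b : R) : has_deriv F f ->
  (forall t, a <= t <= b -> 0 <= f t) -> F b <= F a ->
  forall t, a < t < b -> f t = 0.
Proof.
move=> Ff f0 Fba t /andP[at_ tb].
have E s : a <= s <= b -> F s = F a.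
  move=> /andP[as_ sb]; apply/eqP; rewrite eq_le; apply/andP; split.
    apply: le_trans Fba; apply: (has_deriv_ge0 Ff sb) => u /andP[su ub].
    by apply: f0; rewrite ub (le_trans as_ su).
  apply: (has_deriv_ge0 Ff as_) => u /andP[au us].
  by apply: f0; rewrite au (le_trans us sb).
have [_ <-] := Ff t.
have -> : 'D_1 F t = 'D_1 (cst (F a) : R -> R) t.
  apply: near_eq_derive; near=> s; apply: E.
  have : a < s < b.
    by apply/andP; split; near: s; [exact: lt_nbhsr|exact: lt_nbhsl].
  by move=> /andP[/ltW -> /ltW ->].
by rewrite derive_cst.
Unshelve. all: by end_near.
Qed.

Lemma normr_le_sqr (x y : R) : `|x| <= y -> x ^+ 2 <= y ^+ 2.
Proof.
move=> xy; rewrite -[leLHS]real_normK ?num_real // ler_sqr ?nnegrE //.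
exact: le_trans xy.
Qed.

(** A parabola vanishing at [c - L] and [c + L]. A competitor only has to agree at the two ends, so
    no cut-off is required and a polynomial does. *)
Definition bump (c L t : R) : R := 1 - ((t - c) / L) ^+ 2.

Lemma has_deriv_bump (c L : R) : has_deriv (bump c L) (fun t => - (2 * ((t - c) / L) / L)).
Proof.
have d1 : has_deriv (fun t => (t - c) / L) (fun=> L^-1).
  have := has_derivZ L^-1 (has_derivB (@has_deriv_id R) (has_deriv_cst c)).
  rewrite subr0 mulr1; congr has_deriv; apply/funext => t; exact: mulrC.
apply: has_deriv_ext.
  by apply: has_derivB; [exact: has_deriv_cst|exact: (has_derivM d1 d1)].
by move=> t /=; ring.
Qed.

Lemma smooth1_bump (c L : R) : smooth1 (bump c L).
Proof.
have s1 : smooth1 (fun t => (t + - c) * L^-1).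
  apply: smooth1M; last exact: smooth1_cst.
  by apply: smooth1D; [exact: smooth1_id|exact: smooth1_cst].
have := smooth1D (smooth1_cst 1) (smooth1M (smooth1_cst (- 1)) (smooth1M s1 s1)).
by congr smooth1; apply/funext => t; rewrite /bump; ring.
Qed.

Lemma bump_ratio_le1 (c L t : R) : 0 < L -> c - L <= t <= c + L -> ((t - c) / L) ^+ 2 <= 1.
Proof.
move=> L0 /andP[h1 h2].
rewrite -[leRHS](expr1n _ 2%N); apply: normr_le_sqr.
rewrite normrM normfV (gtr0_norm L0).
by rewrite ler_pdivrMr // mul1r ler_norml; apply/andP; split; lra.
Qed.

Lemma sqr_exp_le1 (t : R) : t <= 0 -> t ^+ 2 * expR (2 * t) <= 1.
Proof.
move=> t0.
have h : - t * expR t <= 1.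
  have := @expR_ge1Dx R (- t); rewrite expRN => h.
  have e0 := expR_gt0 t.
  have : - t <= (expR t)^-1 by lra.
  by rewrite -ler_pdivlMr // div1r.
have -> : t ^+ 2 * expR (2 * t) = (- t * expR t) ^+ 2.
  by rewrite exprMn sqrrN -expRM_natl.
apply: exprn_ile1 => //; apply: mulr_ge0; [lra|exact: expR_ge0].
Qed.

End Tools.

Section Rigidity.
Variable R : realType.
Variable V : R * (R * R) -> R.
Hypothesis sV : smooth_on setT V.
Hypothesis cV : compact (closure [set p | V p != 0]).
Hypothesis rV : forall (s : R) (x y : R * R), sqnorm2 x = sqnorm2 y -> V (s, x) = V (s, y).
Hypothesis HM : all_minimal V.

Local Notation vr := (vrad V).
Local Notation es := (eu R).
Local Notation er := (er R).

Variables A B : R.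
Hypothesis A1 : 1 <= A.
Hypothesis supp : forall vs s r, A <= `|s| \/ A <= `|r| -> vr vs s r = 0.
Hypothesis B0 : 0 <= B.
Hypothesis bnd : forall s r, `|vr [::] s r| <= B.
Hypothesis bnd_s : forall s r, `|vr [:: es] s r| <= B.
Hypothesis bnd_ss : forall s r, `|vr [:: es; es] s r| <= B.
Hypothesis bnd_r : forall s r, `|vr [:: er] s r| <= B.
Hypothesis bnd_rs : forall s r, `|vr [:: er; es] s r| <= B.

Let A0 : 0 < A. Proof. exact: lt_le_trans ltr01 A1. Qed.
Let T : R := ln A.
Let T0 : 0 <= T. Proof. exact: ln_ge0. Qed.
Let eT : expR T = A. Proof. by rewrite lnK. Qed.

Lemma mulr_supp_le (r x M : R) : 0 <= M -> `|x| <= M -> (A <= `|r| -> x = 0) ->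
  `|r * x| <= A * M.
Proof.
move=> M0 xM x0; rewrite normrM; have [h|h] := leP A `|r|.
  by rewrite x0 // normr0 mulr0 mulr_ge0 // ltW.
by apply: ler_pM => //; exact: ltW.
Qed.

Lemma supp_t vs s t : T <= t -> vr vs s (expR t) = 0.
Proof.
move=> tT; apply: supp; right; rewrite ger0_norm ?expR_ge0 //.
by rewrite -eT ler_expR.
Qed.

Lemma lip_s s s' r : `|vr [::] s' r - vr [::] s r| <= B * `|s' - s|.
Proof. exact: (@has_deriv_lip R _ _ B s s' (vrad_deriv_s sV [::] r) (fun t => bnd_s t r)). Qed.

Lemma deriv_psi c : has_deriv (fun t => vr [:: es] c (expR t))
  (fun t => vr [:: er; es] c (expR t) * expR t).
Proof. exact: (has_deriv_comp (vrad_deriv_r sV [:: es] c) (@has_deriv_expR R)). Qed.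

(** * Deformations of a constant solution *)

Section Test.
Variables c d : R.

(** [P] bounds the amplitude [c - A + d psi], and [D] bounds [t^2 e^(2 t)] for [t <= T]. In [E], the
    first term is the kinetic cost of the parabola and the second the error in the potential, both
    up to [1 / L^2]. *)
Let P : R := `|c| + A + `|d| * B.
Let D : R := 1 + T ^+ 2 * A ^+ 2.
Let E : R := 4 * P ^+ 2 + P * B * D.
Let psi (t : R) : R := vr [:: es] c (expR t).
Let psi' (t : R) : R := vr [:: er; es] c (expR t) * expR t.
Let G (L t : R) : R := A + (c - A + d * psi t) * bump 0 L t.
Let g (L t : R) : R := d * psi' t * bump 0 L t
  + (c - A + d * psi t) * - (2 * ((t - 0) / L) / L).

Lemma test_deriv L : has_deriv (G L) (g L).
Proof.
apply: has_deriv_ext.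
  apply: has_derivD; first exact: has_deriv_cst.
  apply: has_derivM (has_deriv_bump 0 L).
  by apply: has_derivD; [exact: has_deriv_cst|apply: has_derivZ; exact: deriv_psi].
by move=> t /=; rewrite !add0r.
Qed.

Lemma test_smooth L : smooth1 (G L).
Proof.
apply: smooth1D; first exact: smooth1_cst.
apply: smooth1M; last exact: smooth1_bump.
apply: smooth1D; first exact: smooth1_cst.
by apply: smooth1M; [exact: smooth1_cst|exact: vrad_smooth1].
Qed.

Lemma test_amp t : `|c - A + d * psi t| <= P.
Proof.
apply: le_trans (ler_normD _ _) _; rewrite lerD //.
  by apply: le_trans (ler_normB _ _) _; rewrite (gtr0_norm A0).
by rewrite normrM ler_wpM2l //; exact: bnd_s.
Qed.

Let P0 : 0 <= P. Proof. exact: le_trans (normr_ge0 _) (test_amp 0). Qed.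
Let D1 : 0 <= D. Proof. by rewrite addr_ge0 // mulr_ge0 // sqr_ge0. Qed.

(** The competitor misses [c + d psi] by the amplitude times [(t / L)^2]. This is not small near the
    ends, but the weight [e^(2 t)] absorbs [t^2] on the left and the potential vanishes for
    [t >= T]. *)
Lemma test_lagr L t : 0 < L -> - L <= t <= L ->
  lagr V (G L) (g L) t <= E / L ^+ 2 + d ^+ 2 * psi' t ^+ 2 -
    expR (2 * t) * vr [::] (c + d * psi t) (expR t).
Proof.
move=> L0 tL.
have tL2 : (t / L) ^+ 2 <= 1.
  have := @bump_ratio_le1 R 0 L t L0; rewrite subr0; apply.
  by rewrite sub0r add0r.
have L2 : 0 < L ^+ 2 by rewrite exprn_gt0.
set a := c - A + d * psi t.
have aP : a ^+ 2 <= P ^+ 2.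
  by apply: normr_le_sqr; exact: test_amp.
(* Half the square of a sum is at most the sum of the squares; this separates the variation of [psi]
   from the slope of the parabola. *)
have kin : 2^-1 * g L t ^+ 2 <= 4 * P ^+ 2 / L ^+ 2 + d ^+ 2 * psi' t ^+ 2.
  have -> : g L t = d * psi' t * bump 0 L t + a * - (2 * (t / L) / L).
    by rewrite /g subr0.
  set x := d * psi' t * bump 0 L t; set y := a * _.
  have xb : x ^+ 2 <= d ^+ 2 * psi' t ^+ 2.
    have b01 : 0 <= bump 0 L t <= 1.
      by rewrite /bump subr0; have := sqr_ge0 (t / L) => ?; apply/andP; split; lra.
    case/andP: b01 => b0 b1; rewrite /x [leLHS]exprMn [in leLHS]exprMn.
    by apply: ler_piMr; [rewrite mulr_ge0 // sqr_ge0|exact: exprn_ile1].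
  have yb : y ^+ 2 <= 4 * P ^+ 2 / L ^+ 2.
    have -> : y ^+ 2 = 4 * (a ^+ 2 * (t / L) ^+ 2) / L ^+ 2.
      by rewrite /y; field; rewrite gt_eqF.
    rewrite ler_pM2r ?invr_gt0 // ler_pM2l //.
    by rewrite -[leRHS]mulr1 ler_pM // sqr_ge0.
  have := sqr_ge0 (x - y); move: xb yb; rewrite sqrrB sqrrD; lra.
have pot : - (expR (2 * t) * vr [::] (G L t) (expR t)) <= P * B * D / L ^+ 2
    - expR (2 * t) * vr [::] (c + d * psi t) (expR t).
  have [tT|/ltW tT] := leP T t.
    by rewrite !supp_t // !mulr0 subr0 oppr0 divr_ge0 ?mulr_ge0 // ltW.
  have tD : t ^+ 2 * expR (2 * t) <= D.
    have [t0|/ltW t0] := leP t 0.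
      apply: le_trans (sqr_exp_le1 t0) _; rewrite /D lerDl.
      by rewrite mulr_ge0 // sqr_ge0.
    rewrite /D ler_wpDl // expRM_natl -eT ler_pM ?sqr_ge0 ?exprn_ge0 ?expR_ge0 //.
      by rewrite ler_sqr ?nnegrE // (le_trans t0).
    by rewrite ler_sqr ?nnegrE ?expR_ge0 // ler_expR.
  have := lip_s (c + d * psi t) (G L t) (expR t).
  have -> : G L t - (c + d * psi t) = - (a * (t / L) ^+ 2).
    by rewrite /G /a /bump subr0; ring.
  rewrite normrN normrM (ger0_norm (sqr_ge0 _)) => lip.
  have e0 := expR_ge0 (2 * t).
  have : expR (2 * t) * `|vr [::] (G L t) (expR t) - vr [::] (c + d * psi t) (expR t)|
      <= P * B * D / L ^+ 2.
    apply: le_trans (ler_wpM2l e0 lip) _.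
    have -> : expR (2 * t) * (B * (`|a| * (t / L) ^+ 2)) =
        `|a| * B * (t ^+ 2 * expR (2 * t)) / L ^+ 2 by field; rewrite gt_eqF.
    rewrite ler_pM2r ?invr_gt0 //; apply: ler_pM => //.
    - by rewrite mulr_ge0.
    - by rewrite mulr_ge0 // sqr_ge0.
    - by rewrite ler_wpM2r //; exact: test_amp.
  move: (vr [::] (G L t) _) (vr [::] (c + _) _) e0 => u v e0.
  have : - (u - v) <= `|u - v| by rewrite -normrN ler_norm.
  move=> /(ler_wpM2l e0); lra.
have -> : E / L ^+ 2 = 4 * P ^+ 2 / L ^+ 2 + P * B * D / L ^+ 2 by rewrite -mulrDl.
rewrite /lagr; lra.
Qed.

(** With [r = e^t] the weight [e^(2 t) dt] becomes [r dr], and as [L -> oo] the window [[-L, L]]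
    fills [[0, A]], the potential being zero beyond. *)
Lemma test_integral Qd :
  has_deriv Qd (fun r => r * vr [::] (c + d * vr [:: es] c r) r) ->
  Qd A - Qd 0 <= d ^+ 2 * (A ^+ 2 * B ^+ 2).
Proof.
(* [2 E] comes from [E / L^2] over a length [2 L], and [A * B] from the missing piece of radii below
   [e^(-L) <= 1 / L]. *)
move=> dQ; apply: (@le_add_inv R _ _ (2 * E + A * B) (Num.max 1 T)) => L.
rewrite ge_max => /andP[L1 LT].
have L0 : 0 < L by exact: lt_le_trans ltr01 L1.
have LL : - L < L by lra.
have eL : expR (- L) <= L^-1.
  by rewrite expRN lef_pV2 ?posrE ?expR_gt0 //; have := expR_ge1Dx L; lra.
have AeL : A <= expR L by rewrite -eT ler_expR.
have psi'c : continuous psi'.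
  move=> t; apply: cvgM; last exact: continuous_expR.
  apply: (@vrad_continuous R V sV _ (fun=> c)); last exact: continuous_expR.
  by move=> u; exact: cvg_cst.
have psic : continuous psi := has_deriv_continuous (deriv_psi c).
have bc : continuous (bump 0 L) := has_deriv_continuous (has_deriv_bump 0 L).
have gc : continuous (g L).
  move=> t; apply: cvgD.
    apply: cvgM; last exact: bc.
    by apply: cvgM; [exact: cvg_cst|exact: psi'c].
  apply: cvgM.
    by apply: cvgD; [exact: cvg_cst|apply: cvgM; [exact: cvg_cst|exact: psic]].
  apply: cvgN; apply: cvgM; last exact: cvg_cst.
  apply: cvgM; first exact: cvg_cst.
  apply: cvgM; last exact: cvg_cst.
  by apply: cvgB; [exact: cvg_id|exact: cvg_cst].
have [N dN] := continuous_has_deriv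
  (lagr_continuous sV (has_deriv_continuous (test_deriv L)) gc).
have h0 : (0 : R) - 0 <= N L - N (- L).
  apply: (@action_minimal R V sV cV rV HM (fun=> A) (fun=> 0) (G L) (g L)
    (fun=> 0) N (- L) L) => //.
  - exact: has_deriv_cst.
  - apply: has_deriv_ext (has_deriv_cst 0) _ => t.
    by rewrite /force supp ?mulr0 ?oppr0 //; left; rewrite gtr0_norm.
  - exact: test_smooth.
  - exact: test_deriv.
  - rewrite /G /bump subr0 mulNr divff ?gt_eqF // sqrrN expr1n subrr mulr0 addr0 //.
  - rewrite /G /bump subr0 divff ?gt_eqF // expr1n subrr mulr0 addr0 //.
  - apply: has_deriv_ext (has_deriv_cst 0) _ => t.
    rewrite /lagr supp; first by rewrite expr0n /= !mulr0 subr0.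
    by left; rewrite gtr0_norm.
have cpsi : continuous (fun r : R => r * vr [:: er; es] c r ^+ 2).
  move=> r; apply: cvgM; first exact: cvg_id.
  by apply: cvgM; exact: (has_deriv_continuous (vrad_deriv_r sV [:: er; es] c)).
have [Ps dPs] := continuous_has_deriv cpsi.
(* An antiderivative of the bound in [test_lagr]; [Ps] and [Qd] are primitives in [r], and composing
   with the exponential supplies the weight. *)
pose U (t : R) := E / L ^+ 2 * t + d ^+ 2 * Ps (expR t) - Qd (expR t).
have dU : has_deriv U (fun t => E / L ^+ 2 + d ^+ 2 * psi' t ^+ 2 -
    expR (2 * t) * vr [::] (c + d * psi t) (expR t)).
  apply: has_deriv_ext.
    apply: has_derivB.
      apply: has_derivD; first by apply: has_derivZ; exact: has_deriv_id.
      by apply: has_derivZ; exact: (has_deriv_comp dPs (@has_deriv_expR R)).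
    exact: (has_deriv_comp dQ (@has_deriv_expR R)).
  by move=> t /=; rewrite expRM_natl /psi' /psi; ring.
have h1 := has_deriv_le dN dU (ltW LL) (fun t => @test_lagr L t L0).
have beyond F f : has_deriv F f -> (forall r, A <= r -> f r = 0) -> F (expR L) = F A.
  move=> Ff f0; apply/eqP; rewrite -subr_eq0 -normr_le0.
  have := has_deriv_abs_le Ff (has_deriv_cst 0) AeL; rewrite subrr; apply.
  by move=> r /andP[Ar _]; rewrite f0 // normr0.
have big r : A <= r -> A <= `|r| by move=> h; apply: le_trans h (ler_norm r).
have h2 : Qd (expR L) = Qd A.
  by apply: beyond dQ _ => r Ar; rewrite supp ?mulr0 //; right; exact: big.
have h3 : Ps (expR L) = Ps A.
  by apply: beyond dPs _ => r Ar; rewrite supp ?expr0n ?mulr0 //; right; exact: big.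
have e1 : 0 < expR (- L) by exact: expR_gt0.
have e2 : expR (- L) <= A.
  by apply: le_trans A1; rewrite -(expR0 R) ler_expR; lra.
have h4 : Ps A - Ps (expR (- L)) <= A ^+ 2 * B ^+ 2.
  apply: le_trans (ler_norm _) _.
  have := @has_deriv_lip R _ _ (A * B ^+ 2) (expR (- L)) A dPs.
  move=> H; apply: le_trans (H _) _ => [r|].
    apply: mulr_supp_le; first exact: sqr_ge0.
      by rewrite ger0_norm ?sqr_ge0 //; apply: normr_le_sqr; exact: bnd_rs.
    by move=> h; rewrite supp ?expr0n //; right.
  rewrite (ger0_norm (_ : 0 <= A - expR (- L))) ?subr_ge0 //.
  have -> : A ^+ 2 * B ^+ 2 = A * B ^+ 2 * A by ring.
  by apply: ler_wpM2l; [rewrite mulr_ge0 ?sqr_ge0 // ltW|lra].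
have h5 : Qd (expR (- L)) - Qd 0 <= A * B / L.
  apply: le_trans (ler_norm _) _.
  have := @has_deriv_lip R _ _ (A * B) 0 (expR (- L)) dQ.
  move=> H; apply: le_trans (H _) _ => [r|].
    by apply: mulr_supp_le => //; move=> h; rewrite supp //; right.
  by rewrite subr0 (gtr0_norm e1); apply: ler_wpM2l => //; rewrite mulr_ge0 // ltW.
have h6 : U L - U (- L) = 2 * E / L + d ^+ 2 * (Ps A - Ps (expR (- L))) - (Qd A - Qd (expR (- L))).
  by rewrite /U h2 h3; field; rewrite gt_eqF.
have h7 : d ^+ 2 * (Ps A - Ps (expR (- L))) <= d ^+ 2 * (A ^+ 2 * B ^+ 2).
  by rewrite ler_wpM2l // sqr_ge0.
have -> : (2 * E + A * B) / L = 2 * E / L + A * B / L by rewrite mulrDl.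
by rewrite h6 in h1; lra.
Qed.

End Test.

Lemma exp_bound (n : nat) vs (x : R) s t : 0 <= x -> `|vr vs s (expR t)| <= x ->
  `|expR (n%:R * t) * vr vs s (expR t)| <= A ^+ n * x.
Proof.
move=> x0 h; have [tT|/ltW tT] := leP T t.
  by rewrite supp_t // mulr0 normr0 mulr_ge0 // exprn_ge0 // ltW.
rewrite normrM ler_pM // ger0_norm ?expR_ge0 // expRM_natl -eT.
by rewrite lerXn2r ?nnegrE ?expR_ge0 // ler_expR.
Qed.

(** * Solutions crossing the support at high speed *)

Section FastSolution.
Variables (t0 p : R) (y z : R -> R).
(** A bound for the total change of speed: the force is at most [B e^(2 t)] and vanishes for
    [t >= T], where [e^T = A]. It does not depend on [p], so for large [p] the speed stays between
    [p / 2] and [2 p]. *)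
Let C1 : R := A ^+ 2 * B.
Hypothesis t0T : t0 <= T.
Hypothesis pC : 2 * C1 + 1 <= p.
Hypothesis yz : has_deriv y z.
Hypothesis zf : has_deriv z (force V y).
Hypothesis yt0 : y t0 = 0.
Hypothesis zt0 : z t0 = p.

Let C10 : 0 <= C1. Proof. by rewrite mulr_ge0 // sqr_ge0. Qed.
Let p0 : 0 < p. Proof. by move: pC C10; lra. Qed.

Lemma speed_var t : `|z t - p| <= C1.
Proof.
have H s t' : s <= t' -> t' <= T -> `|z t' - z s| <= C1.
  move=> st tT.
  have := has_deriv_abs_le zf (has_derivZ (B / 2) (@has_deriv_exp2 R)) st.
  move=> H; apply: le_trans (H _) _ => [u /andP[_ ut]|].
    rewrite /force normrN normrM ger0_norm ?expR_ge0 //.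
    have -> : B / 2 * (2 * expR (2 * u)) = expR (2 * u) * B by field.
    by rewrite ler_wpM2l ?expR_ge0.
  have h1 := expR_ge0 (2 * s).
  have h2 : expR (2 * t') <= A ^+ 2.
    by rewrite expRM_natl -eT lerXn2r ?nnegrE ?expR_ge0 // ler_expR.
  rewrite -mulrBr -mulrA /C1 [leRHS]mulrC ler_wpM2l //.
  by have := sqr_ge0 A; lra.
rewrite -zt0; have [tT|/ltW Tt] := leP t T.
  have [h|/ltW h] := leP t0 t; first exact: H.
  by rewrite distrC; exact: H.
have -> : z t = z T.
  apply/eqP; rewrite -subr_eq0 -normr_le0.
  have := has_deriv_abs_le zf (has_deriv_cst 0) Tt; rewrite subrr; apply.
  by move=> u /andP[Tu _]; rewrite /force supp_t // mulr0 oppr0 normr0.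
exact: H.
Qed.

Lemma speed_bounds t : p / 2 <= z t <= 2 * p.
Proof.
have := speed_var t; rewrite ler_norml => /andP[h1 h2].
by move: pC C10 => *; apply/andP; split; lra.
Qed.

Lemma position_le t : `|y t| <= 2 * p * `|t - t0|.
Proof.
have -> : y t = y t - y t0 by rewrite yt0 subr0.
apply: (has_deriv_lip _ _ yz) => s.
have /andP[h1 h2] := speed_bounds s; rewrite ger0_norm //; move: p0; lra.
Qed.

Lemma position_right t : t0 <= t -> p / 2 * (t - t0) <= y t.
Proof.
move=> h.
have := has_deriv_le (has_derivZ (p / 2) (@has_deriv_id R)) yz h; rewrite yt0 subr0 -mulrBr.
by apply=> s _; rewrite mulr1; case/andP: (speed_bounds s).
Qed.

Lemma position_left t : t <= t0 -> y t <= - (p / 2 * (t0 - t)).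
Proof.
move=> h.
have := has_deriv_le (has_derivZ (p / 2) (@has_deriv_id R)) yz h; rewrite yt0 sub0r -mulrBr.
move=> H; suff : p / 2 * (t0 - t) <= - y t by lra.
by apply: H => s _; rewrite mulr1; case/andP: (speed_bounds s).
Qed.

(** At speed at least [p / 2], the time needed to go from 0 to distance [A]; outside
    [[t0 - d, t0 + d]] the solution is off the support. *)
Let d : R := 2 * A / p.
Let d0 : 0 < d. Proof. by rewrite divr_gt0 // mulr_gt0. Qed.
Let pd : p / 2 * d = A. Proof. by rewrite /d; field; rewrite gt_eqF. Qed.

Lemma position_far t : d <= `|t - t0| -> A <= `|y t|.
Proof.
have [h|/ltW h] := leP t0 t.
  rewrite ger0_norm ?subr_ge0 // => dt; apply: le_trans (ler_norm _).
  apply: le_trans (position_right h); rewrite -pd ler_pM2l // divr_gt0 //.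
rewrite distrC ger0_norm ?subr_ge0 // => dt; rewrite -normrN; apply: le_trans (ler_norm _).
have := position_left h.
have : A <= p / 2 * (t0 - t) by rewrite -pd ler_pM2l // divr_gt0.
by lra.
Qed.

Let wy (t : R) : R := expR (2 * t) * vr [::] (y t) (expR t).

Let cy : continuous y. Proof. exact: has_deriv_continuous yz. Qed.
Let cz : continuous z. Proof. exact: has_deriv_continuous zf. Qed.

Lemma wy_continuous : continuous wy.
Proof.
move=> t; apply: cvgM; first exact: (has_deriv_continuous (@has_deriv_exp2 R)).
by apply: vrad_continuous => //; exact: continuous_expR.
Qed.

Lemma y_smooth1 : smooth1 y. Proof. exact: (solution_smooth1 sV cV yz zf). Qed.

Section Comparison.
Variables (W : R -> R) (th : R).
Hypothesis dW : has_deriv W wy.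
Hypothesis th1 : 1 <= th.
Hypothesis thd : d <= th.
Hypothesis thT : 4 * (T - t0) <= th.
Hypothesis thA : 4 * A <= p * th.

(** The half-width is [th^3] against the height [s = p * th]. The height exceeds what [y] covers
    within [th / 4], while the kinetic cost, of order [s^2 / L], is [p^2 / th] and tends to 0. *)
Let L : R := th ^+ 3.
Let th0 : 0 < th. Proof. exact: lt_le_trans ltr01 th1. Qed.
Let thL : th <= L.
Proof.
by rewrite /L exprS ler_pMr // exprn_ege1.
Qed.
Let L0 : 0 < L. Proof. exact: lt_le_trans th0 thL. Qed.
Let s : R := p * th.

Let G (b : bool) (t : R) : R := y t + (-1) ^+ b * s * bump t0 L t.
Let g (b : bool) (t : R) : R := z t + (-1) ^+ b * s * - (2 * ((t - t0) / L) / L).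

Lemma shift_deriv b : has_deriv (G b) (g b).
Proof. by apply: has_derivD => //; apply: has_derivZ; exact: has_deriv_bump. Qed.

Lemma shift_continuous b : continuous (g b).
Proof.
move=> t; apply: cvgD; first exact: cz.
apply: cvgM; first exact: cvg_cst.
apply: cvgN; apply: cvgM; last exact: cvg_cst.
apply: cvgM; first exact: cvg_cst.
apply: cvgM; last exact: cvg_cst.
by apply: cvgB; [exact: cvg_id|exact: cvg_cst].
Qed.

Lemma shift_smooth b : smooth1 (G b).
Proof.
apply: smooth1D; first exact: y_smooth1.
by apply: smooth1M; [exact: smooth1_cst|exact: smooth1_bump].
Qed.

Lemma shift_boundary b t : `|t - t0| = L -> G b t = y t.
Proof.
move=> h; rewrite /G /bump -real_normK ?num_real // normrM normfV h (gtr0_norm L0).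
by rewrite divff ?gt_eqF // expr1n subrr mulr0 addr0.
Qed.

(** For [|t - t0| <= th / 4] the shift is at least [3 s / 4] and [|y|] at most [s / 2]; what remains
    is [s / 4 >= A], whatever the sign of the shift. *)
Lemma shift_far b t : `|t - t0| <= th / 4 -> A <= `|G b t|.
Proof.
move=> h.
have q0 : ((t - t0) / L) ^+ 2 <= 4^-1.
  have -> : 4^-1 = (2^-1 : R) ^+ 2 by field.
  apply: normr_le_sqr; rewrite normrM normfV (gtr0_norm L0) ler_pdivrMr //; move: thL th0; lra.
have h1 : 3 / 4 * s <= `|(-1) ^+ b * s * bump t0 L t|.
  have s0 : 0 < s by rewrite mulr_gt0.
  rewrite normrM [in leRHS]normrM normrX normrN1 expr1n mul1r (gtr0_norm s0).
  rewrite mulrC; apply: ler_wpM2l; first exact: ltW.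
  by apply: le_trans (ler_norm _); rewrite /bump; lra.
have h2 : `|y t| <= s / 2.
  apply: le_trans (position_le t) _.
  have -> : s / 2 = 2 * p * (th / 4) by rewrite /s; field.
  by rewrite ler_wpM2l // mulr_ge0 // ltW.
have h3 : `|(-1) ^+ b * s * bump t0 L t| - `|y t| <= `|G b t|.
  have -> : (-1) ^+ b * s * bump t0 L t = G b t - y t by rewrite /G; ring.
  by have := ler_normB (G b t) (y t); lra.
by move: thA; rewrite -/s; lra.
Qed.

Lemma shift_action b : exists2 N, has_deriv N (lagr V (G b) (g b)) &
  forall NY, has_deriv NY (lagr V y z) -> NY (t0 + L) - NY (t0 - L) <= N (t0 + L) - N (t0 - L).
Proof.
have [N dN] := continuous_has_deriv
  (lagr_continuous sV (has_deriv_continuous (shift_deriv b)) (@shift_continuous b)).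
exists N => // NY dNY.
apply: (@action_minimal R V sV cV rV HM y z (G b) (g b) NY N (t0 - L) (t0 + L)) => //.
- exact: shift_smooth.
- exact: shift_deriv.
- exact: shift_continuous.
- by move: L0; lra.
- apply: shift_boundary; rewrite (_ : t0 - L - t0 = - L); last by ring.
  by rewrite normrN gtr0_norm.
- apply: shift_boundary; rewrite (_ : t0 + L - t0 = L); last by ring.
  by rewrite gtr0_norm.
Qed.

(** Both shifted actions are at least that of [y]. In their sum minus twice the action of [y] there
    remain the kinetic energy of the shifts, the potential along [y], and the potential along the
    shifted curves, which only counts far to the left. *)
Lemma action_along_ge : - ((4 * p ^+ 2 + C1) / th) <= W (t0 + L) - W (t0 - L).
Proof.
have [NY dNY] := continuous_has_deriv (lagr_continuous sV cy cz).
have [N1 dN1 H1] := shift_action false.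
have [N2 dN2 H2] := shift_action true.
have {}H1 := H1 _ dNY; have {}H2 := H2 _ dNY.
pose N t := N1 t + N2 t - 2 * NY t - 2 * W t.
pose n t := 4 * s ^+ 2 * ((t - t0) / L) ^+ 2 / L ^+ 2
  - expR (2 * t) * vr [::] (G false t) (expR t) - expR (2 * t) * vr [::] (G true t) (expR t).
(* the terms linear in the shift cancel by the parallelogram law *)
have dN : has_deriv N n.
  apply: has_deriv_ext.
    apply: has_derivB; last exact: (has_derivZ 2 dW).
    apply: has_derivB; last exact: (has_derivZ 2 dNY).
    exact: has_derivD dN1 dN2.
  move=> t /=; rewrite /n /lagr /wy /g expr0 expr1; field.
  by rewrite gt_eqF.
have kin t : t0 - L <= t <= t0 + L ->
    4 * s ^+ 2 * ((t - t0) / L) ^+ 2 / L ^+ 2 <= 4 * s ^+ 2 / L ^+ 2.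
  move=> h; rewrite ler_pM2r ?invr_gt0 ?exprn_gt0 //.
  apply: ler_piMr; first by rewrite mulr_ge0 // sqr_ge0.
  exact: bump_ratio_le1.
(* Within [th / 4] of [t0] the shifted curve is off the support in [u]; further right [t >= T], by
   the assumption [thT]. *)
have near_far b t : t0 - th / 4 <= t -> vr [::] (G b t) (expR t) = 0.
  move=> h; have [h1|/ltW h1] := leP t (t0 + th / 4).
    apply: supp; left; apply: shift_far.
    by rewrite ler_norml; apply/andP; split; lra.
  by apply: supp_t; move: thT; lra.
pose k := 4 * s ^+ 2 / L ^+ 2.
have thL' := thL; have th0' := th0.
have i1 : N (t0 - th / 4) - N (t0 - L) <=
    (k * (t0 - th / 4) + B * expR (2 * (t0 - th / 4))) - (k * (t0 - L) + B * expR (2 * (t0 - L))).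
  apply: (has_deriv_le dN (has_derivD (has_derivZ k (@has_deriv_id R))
    (has_derivZ B (@has_deriv_exp2 R)))); first by lra.
  move=> t /andP[ta tb]; rewrite mulr1.
  have tL : t0 - L <= t <= t0 + L by apply/andP; split; lra.
  have := kin t tL; rewrite -/k /n => hk.
  have e0 := expR_ge0 (2 * t).
  have hb b : - (expR (2 * t) * vr [::] (G b t) (expR t)) <= expR (2 * t) * B.
    rewrite -mulrN ler_wpM2l //; apply: le_trans (bnd (G b t) (expR t)).
    by rewrite -normrN ler_norm.
  have := hb true; have := hb false; lra.
have i2 : N (t0 + L) - N (t0 - th / 4) <= k * (t0 + L) - k * (t0 - th / 4).
  apply: (has_deriv_le dN (has_derivZ k (@has_deriv_id R))); first by lra.
  move=> t /andP[ta tb]; rewrite mulr1 /n !near_far // !mulr0 !subr0.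
  by apply: kin; apply/andP; split; lra.
have kL : k * (2 * L) = 8 * p ^+ 2 / th.
  by rewrite /k /s /L; field; rewrite gt_eqF.
(* The left tail of both shifted curves: two integrals of [B e^(2 t)], decaying exponentially in
   [th], weakened to a multiple of [1 / th] to match the kinetic term. *)
have ex : B * expR (2 * (t0 - th / 4)) <= 2 * C1 / th.
  have -> : 2 * (t0 - th / 4) = 2 * t0 - th / 2 by field.
  rewrite expRD.
  have q1 : expR (2 * t0) <= A ^+ 2.
    by rewrite expRM_natl -eT lerXn2r ?nnegrE ?expR_ge0 // ler_expR.
  have q2 : expR (- (th / 2)) <= 2 / th.
    rewrite expRN -[2 / th]invf_div lef_pV2 ?posrE ?expR_gt0 ?divr_gt0 //.
    by have := expR_ge1Dx (th / 2); lra.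
  have -> : 2 * C1 / th = B * (A ^+ 2 * (2 / th)) by rewrite /C1; ring.
  by rewrite ler_wpM2l // ler_pM ?expR_ge0.
have ey := mulr_ge0 B0 (expR_ge0 (2 * (t0 - L))).
have fin : N (t0 + L) - N (t0 - L) <= 8 * p ^+ 2 / th + 2 * C1 / th.
  by rewrite -kL; lra.
have -> : (4 * p ^+ 2 + C1) / th = (8 * p ^+ 2 / th + 2 * C1 / th) / 2.
  by field; rewrite gt_eqF.
by move: fin; rewrite /N; lra.
Qed.

Lemma action_window : W (t0 + L) - W (t0 - L) = W (t0 + d) - W (t0 - d).
Proof.
have dL : d <= L by exact: le_trans thd thL.
have d0' := d0.
have cst0 a b : a <= b -> (forall t, a <= t <= b -> d <= `|t - t0|) -> W b = W a.
  move=> ab h; apply/eqP; rewrite -subr_eq0 -normr_le0.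
  have := has_deriv_abs_le dW (has_deriv_cst 0) ab; rewrite subrr; apply.
  move=> t /h /position_far hA; rewrite /wy supp ?mulr0 ?normr0 //; by left.
rewrite (cst0 (t0 + d) (t0 + L)).
- rewrite (cst0 (t0 - L) (t0 - d)) //; first by lra.
  move=> t /andP[h1 h2]; rewrite distrC; apply: le_trans (ler_norm _); lra.
- by lra.
- move=> t /andP[h1 h2]; apply: le_trans (ler_norm _); lra.
Qed.

End Comparison.

Lemma action_ge0 W : has_deriv W wy -> 0 <= W (t0 + d) - W (t0 - d).
Proof.
move=> dW.
pose th1 := Num.max (Num.max 1 d) (Num.max (4 * (T - t0)) (4 * A / p)).
apply: (@le_add_inv _ _ _ (4 * p ^+ 2 + C1) th1) => th.
rewrite !ge_max => /andP[/andP[h1 h2] /andP[h3 h4]].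
rewrite ler_pdivrMr // [leRHS]mulrC in h4.
have := action_along_ge dW h1 h3; rewrite (action_window dW h1 h2).
by move=> /(_ h4); lra.
Qed.

(** Across the window [c = y t] serves as variable, with [dc] close to [p dt], and [t] is close to
    [t0]. So [p] times the action along [y] approximates [e^(2 t0)] times the integral of [V] over
    [c] at radius [e^t0]. *)
Lemma window_average W Th : has_deriv W wy ->
  has_deriv Th (fun c => vr [::] c (expR t0)) ->
  - (4 * A * (2 * A * (2 * (A ^+ 2 * B) + A ^+ 3 * B) + A ^+ 2 * B * C1) / p) <=
    expR (2 * t0) * (Th A - Th (- A)).
Proof.
move=> dW dTh.
(* [C2] is a Lipschitz constant in [t] of [e^(2 t) V(c, e^t)]. In [C3] the first term is
   [p * C2 * d], the cost of freezing [t], and the second the cost of replacing [z] by [p]; the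
   window length [2 d = 4 A / p] gives the final factor. *)
set C2 := 2 * (A ^+ 2 * B) + A ^+ 3 * B.
set C3 := 2 * A * C2 + A ^+ 2 * B * C1.
have C20 : 0 <= C2 by rewrite addr_ge0 // !mulr_ge0 // ?exprn_ge0 // ltW.
have C30 : 0 <= C3 by rewrite addr_ge0 // !mulr_ge0 // ?sqr_ge0 // ltW.
pose X t := Th (y t).
have dX : has_deriv X (fun t => vr [::] (y t) (expR t0) * z t).
  exact: (has_deriv_comp dTh yz).
have d0' := d0.
have le1 : t0 - d <= t0 + d by lra.
have lipt c t : `|expR (2 * t) * vr [::] c (expR t) - expR (2 * t0) * vr [::] c (expR t0)|
    <= C2 * `|t - t0|.
  have dF : has_deriv (fun t => expR (2 * t) * vr [::] c (expR t))
      (fun t => 2 * (expR (2 * t) * vr [::] c (expR t))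
         + expR (3 * t) * vr [:: er] c (expR t)).
    apply: has_deriv_ext.
      apply: (has_derivM (@has_deriv_exp2 R)).
      exact: (has_deriv_comp (vrad_deriv_r sV [::] c) (@has_deriv_expR R)).
    move=> u /=; have -> : 3 * u = 2 * u + u by ring.
    by rewrite expRD; ring.
  apply: (has_deriv_lip _ _ dF) => u.
  apply: le_trans (ler_normD _ _) _; rewrite lerD //.
    rewrite normrM (ger0_norm (ler0n _ 2)) ler_pM2l //.
    exact: exp_bound.
  exact: exp_bound.
have key : `|(p * W (t0 + d) - expR (2 * t0) * X (t0 + d)) -
    (p * W (t0 - d) - expR (2 * t0) * X (t0 - d))| <= C3 * (t0 + d) - C3 * (t0 - d).
  apply: (has_deriv_abs_le (has_derivB (has_derivZ p dW) (has_derivZ (expR (2 * t0)) dX))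
    (has_derivZ C3 (@has_deriv_id R)) le1) => t /andP[h1 h2].
  rewrite mulr1.
  have td : `|t - t0| <= d by rewrite ler_norml; apply/andP; split; lra.
  have -> : p * wy t - expR (2 * t0) * (vr [::] (y t) (expR t0) * z t) =
     p * (wy t - expR (2 * t0) * vr [::] (y t) (expR t0))
     - expR (2 * t0) * vr [::] (y t) (expR t0) * (z t - p) by ring.
  apply: le_trans (ler_normB _ _) _; rewrite /C3; apply: lerD.
    rewrite normrM (gtr0_norm p0).
    apply: le_trans (_ : p * (C2 * d) <= _).
      rewrite ler_pM2l //; apply: le_trans (lipt _ _) _.
      by rewrite ler_wpM2l.
    by rewrite /d le_eqVlt; apply/orP; left; apply/eqP; field; rewrite gt_eqF.
  rewrite normrM ler_pM //; first exact: exp_bound.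
  exact: speed_var.
have beyond a b : a <= b -> (forall c, a <= c <= b -> A <= `|c|) -> Th b = Th a.
  move=> ab h; apply/eqP; rewrite -subr_eq0 -normr_le0.
  have := has_deriv_abs_le dTh (has_deriv_cst 0) ab; rewrite subrr; apply.
  by move=> c /h hA; rewrite supp ?normr0 //; left.
have yr : A <= y (t0 + d).
  have h : t0 <= t0 + d by lra.
  by have := position_right h; rewrite (_ : t0 + d - t0 = d) ?pd //; ring.
have yl : y (t0 - d) <= - A.
  have h : t0 - d <= t0 by lra.
  by have := position_left h; rewrite (_ : t0 - (t0 - d) = d) ?pd //; ring.
have Xr : X (t0 + d) = Th A.
  by apply: beyond yr _ => c /andP[h _]; apply: le_trans h (ler_norm c).
have Xl : X (t0 - d) = Th (- A).
  apply/esym; apply: beyond yl _ => c /andP[_ h]; rewrite -normrN.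
  by apply: le_trans (ler_norm _); lra.
have W0 := mulr_ge0 (ltW p0) (action_ge0 dW).
have -> : 4 * A * C3 / p = C3 * (t0 + d) - C3 * (t0 - d).
  by rewrite /d; field; rewrite gt_eqF.
by move: key; rewrite Xr Xl ler_norml => /andP[k1 k2]; lra.
Qed.

End FastSolution.

(** Since the force vanishes for [t >= T], its weight never exceeds [A^2]; this gives the uniform
    bound and Lipschitz constant that a global solution needs. *)
Lemma fast_solution t0 p : exists y z, [/\ has_deriv y z, has_deriv z (force V y),
  y t0 = 0 & z t0 = p].
Proof.
pose K s t := - (expR (2 * t) * vr [:: es] s (expR t)).
have := @ode_global_solution R K (A ^+ 2 * B) (A ^+ 2 * B) t0 p.
apply.
- by rewrite mulr_ge0 // sqr_ge0.
- by move=> s t; rewrite normrN; exact: exp_bound.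
- move=> s s' t; rewrite /K opprK addrC.
  have dl : `|vr [:: es] s' (expR t) - vr [:: es] s (expR t)| <= B * `|s' - s|.
    exact: (@has_deriv_lip R _ _ B s s' (vrad_deriv_s sV [:: es] (expR t))
      (fun u => bnd_ss u (expR t))).
  have [tT|/ltW tT] := leP T t.
    by rewrite !supp_t // !mulr0 subrr normr0 !mulr_ge0 // ltW.
  rewrite -mulrBr normrM ger0_norm ?expR_ge0 // -mulrA (distrC s).
  apply: ler_pM; rewrite ?expR_ge0 // expRM_natl -eT.
  by rewrite lerXn2r ?nnegrE ?expR_ge0 // ler_expR.
- move=> y cy t; apply: cvgN; apply: cvgM.
    exact: (has_deriv_continuous (@has_deriv_exp2 R)).
  by apply: vrad_continuous => //; exact: continuous_expR.
Qed.

(** The error in [window_average] is a constant over [p], so it disappears as the initial speed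
    grows; radii beyond [A] are trivial. *)
Lemma average_ge0 r Th : 0 < r -> has_deriv Th (fun c => vr [::] c r) ->
  0 <= Th A - Th (- A).
Proof.
move=> r0 dTh.
have [rA|Ar] := leP r A; last first.
  have AA : - A <= A by have := A0; lra.
  rewrite subr_ge0; apply: (has_deriv_ge0 dTh AA) => c _.
  by rewrite supp //; right; apply: le_trans (ler_norm r); exact: ltW.
pose t0 := ln r.
have et0 : expR t0 = r by rewrite lnK.
have t0T : t0 <= T by rewrite /t0 /T ler_ln.
rewrite -et0 in dTh.
suff : 0 <= expR (2 * t0) * (Th A - Th (- A)) by rewrite pmulr_rge0 // expR_gt0.
pose C := 4 * A * (2 * A * (2 * (A ^+ 2 * B) + A ^+ 3 * B) + A ^+ 2 * B * (A ^+ 2 * B)).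
apply: (@le_add_inv _ _ _ C (2 * (A ^+ 2 * B) + 1)) => p hp.
have [y [z [yz zf y0 z0]]] := fast_solution t0 p.
have [W dW] := continuous_has_deriv (wy_continuous yz).
have := window_average t0T hp yz zf y0 z0 dW dTh; rewrite -/C; lra.
Qed.

(** * Vanishing of the radial means *)

Section Mean.
Variable Q : R -> R -> R.
Hypothesis dQ : forall c, has_deriv (Q c) (fun r => r * vr [::] c r).

Lemma mean_le0 c : Q c A - Q c 0 <= 0.
Proof.
have := @test_integral c 0 (Q c); rewrite expr0n /= mul0r; apply.
by apply: has_deriv_ext (dQ c) _ => r; rewrite mul0r addr0.
Qed.

Lemma mean_continuous r : continuous (fun c => Q c r - Q c 0).
Proof.
apply: (@lipschitz_continuous R _ (A * B * `|r|)) => c c'.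
have := @has_deriv_lip R _ _ (A * (B * `|c' - c|)) 0 r (has_derivB (dQ c') (dQ c)).
rewrite subr0.
have -> : Q c' r - Q c' 0 - (Q c r - Q c 0) = Q c' r - Q c r - (Q c' 0 - Q c 0) by ring.
have -> : A * B * `|r| * `|c' - c| = A * (B * `|c' - c|) * `|r| by ring.
apply=> t; rewrite -mulrBr; apply: mulr_supp_le; first by rewrite mulr_ge0.
  exact: lip_s.
by move=> h; rewrite !supp ?subrr //; right.
Qed.

(** Fubini by hand: as a function of the upper radius the double integral [J] has derivative
    [r * M r], where [M r] is the integral of [V] over [c]. This is nonnegative by [average_ge0],
    and [J 0 = 0]. *)
Lemma mean_integral_ge0 P : has_deriv P (fun c => Q c A - Q c 0) -> 0 <= P A - P (- A).
Proof.
move=> dPA.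
have /choice[Pr dP] r : exists F, has_deriv F (fun c => Q c r - Q c 0).
  by apply: continuous_has_deriv; exact: mean_continuous.
have /choice[Th dTh] r : exists F, has_deriv F (fun c => vr [::] c r).
  by apply: continuous_has_deriv; exact: (has_deriv_continuous (vrad_deriv_s sV [::] r)).
pose J r := Pr r A - Pr r (- A).
pose M r := Th r A - Th r (- A).
have AA : - A <= A by have := A0; lra.
have dJ : has_deriv J (fun r => r * M r).
  move=> r.
  (* A bound, uniform in [c], for the derivative of [r V(c, r)] in [r]. It makes the Taylor
     remainder quadratic uniformly in [c], which justifies differentiating under the integral. *)
  pose C := B + A * B.
  have C0 : 0 <= C by rewrite addr_ge0 // mulr_ge0 // ltW.
  pose rho x := J x - J r - r * M r * (x - r).
  have rhoE x : `|rho x| <= A * C * (`|x - r| * (`|x - r| + `|x - r|)).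
    have := has_deriv_abs_le (has_derivB (has_derivB (dP x) (dP r))
      (has_derivZ (r * (x - r)) (dTh r))) (has_derivZ (C * `|x - r| ^+ 2) (@has_deriv_id R)) AA.
    have -> : C * `|x - r| ^+ 2 * A - C * `|x - r| ^+ 2 * - A =
      A * C * (`|x - r| * (`|x - r| + `|x - r|)) by ring.
    have -> : Pr x A - Pr r A - r * (x - r) * Th r A -
      (Pr x (- A) - Pr r (- A) - r * (x - r) * Th r (- A)) = rho x by rewrite /rho /J /M; ring.
    apply=> c _; rewrite mulr1.
    have -> : Q c x - Q c 0 - (Q c r - Q c 0) - r * (x - r) * vr [::] c r =
      Q c x - Q c r - r * vr [::] c r * (x - r) by ring.
    have dF : has_deriv (fun u => u * vr [::] c u) (fun u => vr [::] c u + u * vr [:: er] c u).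
      apply: has_deriv_ext (has_derivM (@has_deriv_id R) (vrad_deriv_r sV [::] c)) _ => u.
      by rewrite mul1r.
    apply: (has_deriv_taylor1 r x (dQ c) dF) => u.
    apply: le_trans (ler_normD _ _) _; apply: lerD; first exact: bnd.
    by apply: mulr_supp_le => // h; rewrite supp //; right.
  have drho : is_derive r (1 : R) rho 0.
    apply: (@is_derive_remainder R rho id id r (A * C) 1 1) => //.
    by rewrite mulr_ge0 // ltW.
  have := is_deriveD drho (has_derivZ (r * M r) (@has_deriv_id R) r).
  move=> /(is_deriveD (is_derive_cst (J r - r * M r * r) r (1 : R))).
  rewrite !add0r mulr1.
  have -> // : cst (J r - r * M r * r) + (rho + (fun t => r * M r * t)) = J.
  apply/funext => x.
  have -> : (cst (J r - r * M r * r) + (rho + (fun t => r * M r * t))) x =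
    J r - r * M r * r + (rho x + r * M r * x) by [].
  by rewrite /rho; ring.
have J0 : J 0 = 0.
  have := has_deriv_eq (- A) A (dP 0) (_ : has_deriv (fun=> 0) (fun c => Q c 0 - Q c 0)).
  rewrite subrr; apply.
  by apply: has_deriv_ext (has_deriv_cst 0) _ => c; rewrite subrr.
have JA : J 0 <= J A.
  apply: (has_deriv_ge0 dJ (ltW A0)) => r /andP[r0 _].
  move: r0; rewrite le_eqVlt => /predU1P[<-|r0]; first by rewrite mul0r.
  by rewrite mulr_ge0 ?(ltW r0) //; exact: average_ge0 (dTh r).
by rewrite (has_deriv_eq (- A) A dPA (dP A)) -J0.
Qed.

(** The means are nonpositive for each [c], yet their integral over [[- A, A]] is nonnegative;
    outside this interval [V] vanishes. *)
Lemma mean_eq0 c : Q c A - Q c 0 = 0.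
Proof.
have [h|h] := leP A `|c|.
  rewrite (has_deriv_eq 0 A (dQ c) (_ : has_deriv (fun=> 0) _)) ?subrr //.
  by apply: has_deriv_ext (has_deriv_cst 0) _ => r; rewrite supp ?mulr0 //; left.
have [P dP] := continuous_has_deriv (@mean_continuous A).
have PA := mean_integral_ge0 dP.
apply/eqP; rewrite -oppr_eq0; apply/eqP.
apply: (has_deriv_eq0 (has_derivN dP) (a := - A) (b := A)).
- by move=> t _; rewrite oppr_ge0; exact: mean_le0.
- by lra.
- by rewrite -ltr_norml.
Qed.

End Mean.

Lemma vrad_continuous_r vs c : continuous (vr vs c).
Proof. exact: (has_deriv_continuous (vrad_deriv_r sV vs c)). Qed.

(** For [psi = V_u(c, .)] the first variation of the mean is [X], the integral of [r psi^2]. A gain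
    [d X] linear in [d] cannot stay below a cost quadratic in [d] unless [X] is zero. *)
Lemma dV_eq0 c r : 0 < r -> vr [:: es] c r = 0.
Proof.
move=> r0; have [Ar|rA] := leP A r.
  by apply: supp; right; apply: le_trans Ar (ler_norm r).
have /choice[Q dQ] c' : exists F, has_deriv F (fun r => r * vr [::] c' r).
  apply: continuous_has_deriv => t.
  by apply: cvgM; [exact: cvg_id|exact: vrad_continuous_r].
pose psi := vr [:: es] c.
have [X dX] : exists X, has_deriv X (fun r => r * psi r ^+ 2).
  apply: continuous_has_deriv => t.
  by apply: cvgM; [exact: cvg_id|apply: cvgM; exact: vrad_continuous_r].
have [C C0 HC] := vrad_taylor sV cV [::].
pose K := A ^+ 2 * B ^+ 2.
have X0 : X A - X 0 <= 0.
  apply: (@le_add_inv _ _ _ (K + C * (X A - X 0)) 1) => L L1.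
  have L0 : 0 < L by exact: lt_le_trans ltr01 L1.
  pose d := L^-1.
  have d0 : 0 < d by rewrite invr_gt0.
  have [Qd dQd] : exists F, has_deriv F (fun r => r * vr [::] (c + d * psi r) r).
    apply: continuous_has_deriv => t; apply: cvgM; first exact: cvg_id.
    apply: (@vrad_continuous R V sV _ (fun r => c + d * psi r) id) => u; last exact: cvg_id.
    by apply: cvgD; [exact: cvg_cst|apply: cvgM; [exact: cvg_cst|exact: vrad_continuous_r]].
  have h1 := test_integral dQd.
  (* Taylor in [u] bounds [V(c + d psi, r)] below by [V(c, r) + (d - C d^2) psi^2], so all error
     terms are again multiples of the integrand of [X]. *)
  have h2 := has_deriv_le (has_derivD (dQ c) (has_derivZ (d - C * d ^+ 2) dX)) dQd (ltW A0).
  have {}h2 : Q c A + (d - C * d ^+ 2) * X A - (Q c 0 + (d - C * d ^+ 2) * X 0) <= Qd A - Qd 0.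
    apply: h2 => t /andP[t0 _].
    have := HC c (c + d * psi t) t.
    have -> : c + d * psi t - c = d * psi t by ring.
    rewrite real_normK ?num_real // ler_norml => /andP[h _].
    have -> : t * vr [::] c t + (d - C * d ^+ 2) * (t * psi t ^+ 2) =
      t * (vr [::] c t + (d - C * d ^+ 2) * psi t ^+ 2) by ring.
    by rewrite ler_wpM2l //; move: h; rewrite -/(psi t) exprMn; lra.
  have h3 := mean_eq0 dQ c.
  have h4 : d * (X A - X 0) <= d * (d * (K + C * (X A - X 0))).
    by rewrite -/K in h1; lra.
  by rewrite ler_pM2l // in h4; rewrite add0r [leRHS]mulrC.
have : r * psi r ^+ 2 = 0.
  apply: (has_deriv_eq0 dX (a := 0) (b := A)); [|lra|by rewrite r0].
  by move=> t /andP[t0 _]; rewrite mulr_ge0 // sqr_ge0.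
move=> /eqP; rewrite mulf_eq0 gt_eqF //= sqrf_eq0 => /eqP; exact.
Qed.

Lemma V_eq0 p : V p = 0.
Proof.
have pos s r : 0 < r -> vr [::] s r = 0.
  move=> r0; rewrite -(@supp [::] A r); last by left; exact: ler_norm.
  apply: (@is_derive_0_is_cst R (vr [::] ^~ r)) => t.
  by have := vrad_deriv_s sV [::] r t; rewrite dV_eq0.
case: p => s x; have [->|x0] := eqVneq x 0; last first.
  by rewrite (V_radial rV) // pos // expR_gt0.
(* The origin is reached by continuity: [V] vanishes at radius [1 / L] and is [B]-Lipschitz along
   the ray. *)
apply/eqP; rewrite -normr_le0; apply: (@le_add_inv _ _ _ B 1) => L L1.
have L0 : 0 < L by exact: lt_le_trans ltr01 L1.
have := @has_deriv_lip R _ _ B L^-1 0 (vrad_deriv_r sV [::] s) (bnd_r s).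
have L'0 : 0 < L^-1 by rewrite invr_gt0.
by rewrite (pos _ L^-1) // subr0 sub0r normrN (gtr0_norm L'0) add0r.
Qed.

End Rigidity.

Theorem theorem2 (R : realType) (V : R * (R * R) -> R) :
  smooth_on setT V ->
  compact (closure [set p | V p != 0]) ->
  (forall (s : R) (x y : R * R), sqnorm2 x = sqnorm2 y -> V (s, x) = V (s, y)) ->
  (exists p, V p != 0) ->
  exists u : R * R -> R,
    let D := [set x : R * R | x != 0] in
    smooth_on D u /\
    (forall x y, D x -> D y -> sqnorm2 x = sqnorm2 y -> u x = u y) /\
    (forall x, D x -> laplacian u x = - 'D_(eu R) V (u x, x)) /\
    ~ minimal V D u.
Proof.
move=> sV cV rV [p Vp]; apply: contrapT => nex.
have HM : all_minimal V.
  move=> u [h1 h2 h3]; apply: contrapT => h4; apply: nex.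
  by exists u; split => //.
have [A A1 supp] := vrad_supp cV.
have [B0 B00 b0] := vrad_bounded sV cV [::].
have [B1 B10 b1] := vrad_bounded sV cV [:: eu R].
have [B2 B20 b2] := vrad_bounded sV cV [:: eu R; eu R].
have [B3 B30 b3] := vrad_bounded sV cV [:: er R].
have [B4 B40 b4] := vrad_bounded sV cV [:: er R; eu R].
(* A single constant dominating [V] and the four derivatives that occur in the estimates. *)
pose B := B0 + B1 + B2 + B3 + B4.
have : V p = 0.
  by apply: (@V_eq0 R V sV cV rV HM A B A1 supp) => [|s r|s r|s r|s r|s r];
    rewrite /B ?addr_ge0 //; [have := b0 s r|have := b1 s r|have := b2 s r|
      have := b3 s r|have := b4 s r]; lra.
by move=> Vp0; rewrite Vp0 eqxx in Vp.
Qed.
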